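(* Let $\mathbf S$ be the set of all $\underline r\in F((z^{-1}))^m$ with $v(\underline r)>0$, and let $\mathbf C^*$ be the set of all strict $m$-continued fractions. Then: (1) $\mathbf T(\underline r)=\mathbf C(\underline r)$ for all $\underline r\in\mathbf S$; (2) the mapping $\psi$ is a bijection from $\mathbf S$ onto $\mathbf C^*$, and $\varphi$ is its inverse.
   Context: Let $F$ be a field, $m\ge 1$ an integer, $Z_m=\{1,\dots,m\}$. $F((z^{-1}))$ is the field of formal Laurent series $\sum_{t\ge i}a_tz^{-t}$ ($i\in\mathbb Z$, $a_t\in F$), with valuation $v(\sum_{t\ge i}a_tz^{-t})=i$ if $a_i\ne 0$, and $v(0)=\infty$. Elements of $F((z^{-1}))^m$ are column vectors; $\underline e_j$ is the $j$-th standard basis vector. For $\alpha\in F((z^{-1}))$, $\lfloor\alpha\rfloor\in F[z]$ is the polynomial part (terms $z^{i}$, $i\ge0$) and $\{\alpha\}=\alpha-\lfloor\alpha\rfloor$; both are extended componentwise to vectors. Order $Z_m\times\mathbb Z$ linearly by $(h,v)<(h',v')$ iff $v<v'$, or $v=v'$ and $h<h'$. For $\underline r=(r_1,\dots,r_m)^\tau\ne\underline 0$ put $v(\underline r)=\min_i v(r_i)$, $I(\underline r)=\min\{i: v(r_i)=v(\underline r)\}$ and $Iv(\underline r)=(I(\underline r),v(\underline r))$; $v(\underline 0)=\infty$, $Iv(\underline 0)=(1,\infty)$, which is larger than every element of $Z_m\times\mathbb Z$. A monomial is $z^x\underline e_j$ ($x\in\mathbb Z$, $j\in Z_m$), so $Iv(z^x\underline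 e_j)=(j,-x)$. Every $\underline r$ is uniquely a (possibly infinite) $F$-combination of monomials; those with nonzero coefficient are the monomials of $\underline r$. If $\underline r\neq \underline 0$ has finitely many monomials, $Supp^+(\underline r)$ is the largest of the values $Iv(\underline m)$ over monomials $\underline m$ of $\underline r$. $m$-continued fractions. An $m$-pre-continued fraction of length $\omega$ ($\omega$ a positive integer or $\infty$) is $C=[\underline a_0,h_1,\underline a_1,h_2,\underline a_2,\dots]$ with $\underline a_0=\underline 0$, $h_k\in Z_m$ and $\underline a_k=(a_{k,1},\dots,a_{k,m})^\tau\in F[z]^m$ for $1\le k<\omega$. Let $E_h$ be the matrix obtained from $I_{m+1}$ by exchanging columns $h$ and $m+1$, and $A(\underline a)=\begin{pmatrix} I_m&\underline a\\0&1\end{pmatrix}$. Put $B_0=I_{m+1}$, $B_k=B_{k-1}E_{h_k}A(\underline a_k)$ for $1\le k<\omega$; the last column of $B_k$ is written $\begin{pmatrix}\underline p_k\\ q_k\end{pmatrix}$ with $\underline p_k\in F[z]^m$, $q_k\in F[z]$. Condition 1: $\deg a_{k,h_k}\ge 1$ for $1\le k<\omega$. Under Condition 1 put $t_k=\deg a_{k,h_k}$, $v_{k,j}=\sum_{1\le i\le k,\,h_i=j}t_i$ (so $v_{0,j}=0$), $v_k=v_{k,h_k}$, $D_k=\mathrm{Diag}(z^{-v_{k,1}},\dots,z^{-v_{k,m}})$. Condition 2: $(h_k,v_{k-1,h_k})<(h_{k+1},v_{k+1})$ for $1\le k<\omega-1$. Condition 3: $Iv(D_k\underline a_k)=(h_k,v_{k-1,h_k})$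 for $1\le k<\omega$. Condition 4: $Supp^+(D_k\underline a_k)<(h_{k+1},v_{k+1})$ for $1\le k<\omega-1$. (Convention $\infty-1=\infty$.) An $m$-continued fraction is an $m$-pre-continued fraction satisfying Conditions 1, 2, 3; it is strict if it also satisfies Condition 4. For an $m$-continued fraction $C$ all $q_k$ are nonzero, and $\varphi(C)=\underline p_{\omega-1}/q_{\omega-1}$ if $\omega<\infty$, $\varphi(C)=\lim_{k\to\infty}\underline p_k/q_k$ (which exists) if $\omega=\infty$. $\mathbf C(\underline r)$ is the set of all $m$-continued fractions $C$ with $\varphi(C)=\underline r$. $m$-CF transform of $\underline r\in F((z^{-1}))^m$ with $v(\underline r)>0$. Start with $\underline a_0=\underline 0$, $\Delta_{-1}=I_m$ (i.e. $c_{0,j}=0$ for all $j$), $\beta_0=\underline r$. Suppose for some $k\ge1$ that $\Delta_{k-2}=\mathrm{Diag}(z^{-c_{k-1,1}},\dots,z^{-c_{k-1,m}})$ and $\beta_{k-1}=(\beta_{k-1,1},\dots,\beta_{k-1,m})^\tau$ have been defined. If $\beta_{k-1}=\underline 0$, stop and put $\omega=k$ (for $\underline r=\underline 0$ this gives $C=[\underline 0]$, $\omega=1$). Otherwise: (i) $h_k=I(\Delta_{k-2}\beta_{k-1})$; (ii) $\Delta_{k-1}=\mathrm{Diag}(z^{-c_{k,1}},\dots,z^{-c_{k,m}})$ with $c_{k,j}=c_{k-1,j}$ for $j\ne h_k$ and $c_{k,h_k}=v(\Delta_{k-2}\beta_{k-1})$; (iii) let $\rho_k=(\rho_{k,1},\dots,\rho_{k,m})^\tau$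 with $\rho_{k,j}=\beta_{k-1,j}/\beta_{k-1,h_k}$ for $j\ne h_k$ and $\rho_{k,h_k}=1/\beta_{k-1,h_k}$; choose freely $\underline\epsilon_k\in F[z]^m$ subject to $Iv(\Delta_{k-1}\{\rho_k\})\le Iv(\Delta_{k-1}\underline\epsilon_k)$, and put $\underline a_k=\lfloor\rho_k\rfloor-\underline\epsilon_k$, $\beta_k=\{\rho_k\}+\underline\epsilon_k$. If the procedure never stops, $\omega=\infty$. The output is $C=[\underline 0,h_1,\underline a_1,h_2,\underline a_2,\dots]$ of length $\omega$. $\mathbf T(\underline r)$ is the set of all outputs over all admissible choices of the $\underline\epsilon_k$. The map $\psi$. For $\Delta$ a diagonal matrix of order $m$ whose diagonal entries are powers of $z$ and $\underline\rho\in F((z^{-1}))^m$, the $\Delta$-polynomial part $\lfloor\underline\rho\rfloor^-_\Delta$ is the sum of those terms $c_{\underline m}\underline m$ of $\lfloor\underline\rho\rfloor$ (in its monomial expansion) with $Iv(\Delta\underline m)<Iv(\Delta\{\underline\rho\})$. $\psi(\underline r)\in\mathbf T(\underline r)$ is the output of the $m$-CF transform when at every step one chooses $\underline a_k=\lfloor\rho_k\rfloor^-_{\Delta_{k-1}}$, i.e. $\underline\epsilon_k=\lfloor\rho_k\rfloor-\lfloor\rho_k\rfloor^-_{\Delta_{k-1}}$ (an admissible choice). *)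

(* Defs.v *)
From HB Require Import structures.
From mathcomp Require Import all_boot all_order all_algebra.
From mathcomp Require Import mathcomp_extra boolp classical_sets functions.
From mathcomp Require Import cardinality fsbigop constructive_ereal.
From mathcomp Require Import zify.

Set Implicit Arguments.
Unset Strict Implicit.
Unset Printing Implicit Defensive.

Import Order.TTheory GRing.Theory Num.Theory.

Local Open Scope classical_set_scope.
Local Open Scope ring_scope.

(* Formal Laurent series in z^-1: [lcoef a t] is the coefficient of z^(-t). *)

Definition vanishes_below (R : nmodType) (N : int) (f : int -> R) : Prop :=
  forall t, t < N -> f t = 0.

Record laurent (F : fieldType) := Laurent {
  lcoef :> int -> F;
  laurent_bound : exists N, vanishes_below N lcoef }.

HB.instance Definition _ (F : fieldType) := gen_eqMixin (laurent F).
HB.instance Definition _ (F : fieldType) := gen_choiceMixin (laurent F).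

Section LaurentField.
Variable F : fieldType.
Implicit Types (a b c : laurent F) (N M t : int).

Lemma laurentP a b : (forall t, a t = b t) -> a = b.
Proof.
case: a b => f hf [g hg] /= /funext fg.
by move: hf hg; rewrite fg => hf hg; congr Laurent; exact: Prop_irrelevance.
Qed.

Lemma lower_bound2 a b : exists N, vanishes_below N a /\ vanishes_below N b.
Proof.
have [N aN] := laurent_bound a; have [M bM] := laurent_bound b.
by exists (Num.min N M); split=> t; rewrite lt_min => /andP[??]; auto.
Qed.

Lemma lzero_bound : exists N, vanishes_below N (fun _ => 0 : F).
Proof. by exists 0. Qed.

Lemma lopp_bound a : exists N, vanishes_below N (fun t => - a t).
Proof. by have [N aN] := laurent_bound a; exists N => t /aN ->; rewrite oppr0. Qed.

Lemma ladd_bound a b : exists N, vanishes_below N (fun t => a t + b t).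
Proof.
by have [N [aN bN]] := lower_bound2 a b; exists N => t tN; rewrite aN // bN // addr0.
Qed.

Definition lzero := Laurent lzero_bound.
Definition lopp a := Laurent (lopp_bound a).
Definition ladd a b := Laurent (ladd_bound a b).

Lemma laddA : associative ladd.
Proof. by move=> a b c; apply: laurentP => t /=; rewrite addrA. Qed.
Lemma laddC : commutative ladd.
Proof. by move=> a b; apply: laurentP => t /=; rewrite addrC. Qed.
Lemma ladd0 : left_id lzero ladd.
Proof. by move=> a; apply: laurentP => t /=; rewrite add0r. Qed.
Lemma laddN : left_inverse lzero lopp ladd.
Proof. by move=> a; apply: laurentP => t /=; rewrite addNr. Qed.

HB.instance Definition _ :=
  GRing.isZmodule.Build (laurent F) laddA laddC ladd0 laddN.

(* Only finitely many summands are nonzero. *)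
Definition lconv a b t : F := \sum_(i \in [set: int]) a i * b (t - i).

Lemma lconvE a b N M (n : nat) t : vanishes_below N a -> vanishes_below M b ->
  t - N - M < n%:Z -> lconv a b t = \sum_(i < n) a (N + i%:Z) * b (t - N - i%:Z).
Proof.
move=> aN bM tn; rewrite /lconv.
pose s := [seq N + (i : nat)%:Z | i <- iota 0 n].
have us : uniq s by rewrite map_inj_uniq ?iota_uniq // => i j; lia.
rewrite -(big_mkord xpredT (fun i : nat => a (N + i%:Z) * b (t - N - i%:Z))).
transitivity (\sum_(j <- s) a j * b (t - j)).
  rewrite (fsbig_seq _ _ us); apply/esym/fsbig_widen => //.
  move=> j /= [_]; case: (ltP j N) => jN; first by rewrite aN ?mul0r.
  case: (ltP (t - j) M) => tM; first by rewrite bM ?mulr0.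
  case; apply/mapP; exists `|j - N|%N; last lia.
  by rewrite mem_iota; lia.
rewrite big_map /index_iota subn0; apply: eq_bigr => i _.
by rewrite opprD addrA.
Qed.

Lemma lconv_lt a b N M t : vanishes_below N a -> vanishes_below M b ->
  t < N + M -> lconv a b t = 0.
Proof. by move=> aN bM tNM; rewrite (lconvE (n := 0) aN bM) ?big_ord0//; lia. Qed.

Lemma lmul_bound a b : exists N, vanishes_below N (lconv a b).
Proof.
have [N aN] := laurent_bound a; have [M bM] := laurent_bound b.
by exists (N + M) => t; exact: lconv_lt.
Qed.

Definition lmul a b := Laurent (lmul_bound a b).

(* [ltrunc N n a] is the polynomial with coefficients a_N, ..., a_(N+n). *)
Let ltrunc N n a : {poly F} := \poly_(i < n.+1) a (N + i%:Z).

Let coef_mul_low (p p' q q' : {poly F}) n :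
  (forall i, (i <= n)%N -> p`_i = p'`_i) ->
  (forall i, (i <= n)%N -> q`_i = q'`_i) -> (p * q)`_n = (p' * q')`_n.
Proof.
move=> hp hq; rewrite !coefM; apply: eq_bigr => i _.
by rewrite hp ?hq ?leq_subr// -ltnS.
Qed.

Let lmulE a b N M (m n : nat) : vanishes_below N a -> vanishes_below M b ->
  (m <= n)%N -> lmul a b (N + M + m%:Z) = (ltrunc N n a * ltrunc M n b)`_m.
Proof.
move=> aN bM mn; rewrite /= (lconvE (n := m.+1) aN bM); last lia.
rewrite coefM; apply: eq_bigr => i _; have im := ltn_ord i.
rewrite !coef_poly !ifT; [|lia|lia].
by congr (_ * b _); lia.
Qed.

Lemma lmulC : commutative lmul.
Proof.
move=> a b; apply: laurentP => t.
have [N aN] := laurent_bound a; have [M bM] := laurent_bound b.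
have [tNM|tNM] := ltP t (N + M).
  by rewrite /= (lconv_lt aN bM) // (lconv_lt bM aN) // addrC.
have -> : t = N + M + (absz (t - N - M)%R)%:Z by lia.
by rewrite (lmulE aN bM (leqnn _)) [N + M]addrC (lmulE bM aN (leqnn _)) mulrC.
Qed.

Lemma lmulDl : left_distributive lmul ladd.
Proof.
move=> a b c; apply: laurentP => t.
have [N [aN bN]] := lower_bound2 a b; have [M cM] := laurent_bound c.
have abN : vanishes_below N (ladd a b) by move=> u uN /=; rewrite aN ?bN ?addr0.
pose n := (absz (t - N - M)%R).+1.
rewrite /= !(lconvE (n := n) _ cM _ (N := N))//; try by rewrite /n; lia.
by rewrite -big_split/=; apply: eq_bigr => i _; rewrite mulrDl.
Qed.

Lemma lmulA : associative lmul.
Proof.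
move=> a b c; apply: laurentP => t.
have [N aN] := laurent_bound a; have [M bM] := laurent_bound b.
have [K cK] := laurent_bound c.
have abNM : vanishes_below (N + M) (lmul a b) by move=> u; exact: lconv_lt.
have bcMK : vanishes_below (M + K) (lmul b c) by move=> u; exact: lconv_lt.
have [tl|tl] := ltP t (N + M + K).
  by rewrite [LHS](lconv_lt aN bcMK) ?addrA// [RHS](lconv_lt abNM cK).
have -> : t = N + M + K + (absz (t - N - M - K)%R)%:Z by lia.
set n := absz _.
rewrite (lmulE abNM cK (leqnn n)) -addrA -addrA [M + (K + _)]addrA addrA.
rewrite (lmulE aN bcMK (leqnn n)).
transitivity ((ltrunc N n a * (ltrunc M n b * ltrunc K n c))`_n).
  apply: coef_mul_low => // i le_in; rewrite -(lmulE bM cK le_in).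
  by rewrite coef_poly ltnS le_in.
rewrite mulrA; apply: coef_mul_low => // i le_in; rewrite -(lmulE aN bM le_in).
by rewrite coef_poly ltnS le_in.
Qed.

Lemma lmono_bound n : exists N, vanishes_below N (fun t => (t == n)%:R : F).
Proof. by exists n => t tn; rewrite lt_eqF. Qed.

Definition lone := Laurent (lmono_bound 0).

Lemma lmul1 : left_id lone lmul.
Proof.
move=> a; apply: laurentP => t; have [N aN] := laurent_bound a.
have l0 : vanishes_below 0 lone by move=> u u0; rewrite /= lt_eqF.
rewrite /= (lconvE (n := `|t - N|.+1) l0 aN); last lia.
rewrite big_ord_recl big1 /= ?addr0 ?mul1r ?subr0//.
by move=> i _; rewrite mul0r.
Qed.

Lemma lone_neq0 : lone != lzero.
Proof.
by apply/eqP => /(congr1 (fun a => lcoef a 0)) /= /eqP; rewrite oner_eq0.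
Qed.

HB.instance Definition _ := GRing.Zmodule_isComNzRing.Build (laurent F)
  lmulA lmulC lmul1 lmulDl lone_neq0.

Lemma laurent_order a : a != 0 ->
  exists i, a i != 0 /\ vanishes_below i a.
Proof.
move=> a0; have [N aN] := laurent_bound a.
have : exists n : nat, a (N + n%:Z) != 0.
  apply: contrapT => /forallNP h; move/eqP: a0; apply; apply: laurentP => t.
  have [/aN//|Nt] := ltP t N.
  have := h `|t - N|%N; rewrite (_ : N + _ = t); last lia.
  by move/negP; rewrite negbK => /eqP.
move=> exn; exists (N + (ex_minn exn)%:Z); case: ex_minnP => n an nmin.
split=> // t tn; have [/aN//|Nt] := ltP t N.
apply/eqP; apply: contraTT isT => at0.
have := nmin `|t - N|%N; rewrite (_ : N + _ = t); last lia.
by move/(_ at0); lia.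
Qed.

(* The first n coefficients of the inverse of the power series with
   coefficients f, where f 0 != 0. *)
Let Fixpoint inv_coefs (f : nat -> F) (n : nat) : seq F :=
  if n is n'.+1 then
    let s := inv_coefs f n' in
    rcons s ((f 0%N)^-1 * ((n' == 0%N)%:R - \sum_(i < n') f i.+1 * s`_(n' - i.+1)))
  else [::].

Let size_inv_coefs f n : size (inv_coefs f n) = n.
Proof. by elim: n => //= n IHn; rewrite size_rcons IHn. Qed.

Let nth_inv_coefs f m n : (m < n)%N -> (inv_coefs f n)`_m = (inv_coefs f m.+1)`_m.
Proof.
elim: n => // n IHn; rewrite ltnS leq_eqVlt => /orP[/eqP->//|mn].
by rewrite -IHn//= nth_rcons size_inv_coefs mn.
Qed.

Let inv_coefsP (f : nat -> F) n : f 0%N != 0 ->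
  \sum_(i < n.+1) f i * (inv_coefs f (n - i).+1)`_(n - i) = (n == 0%N)%:R.
Proof.
move=> f0; rewrite big_ord_recl subn0 [inv_coefs f n.+1]/=.
rewrite nth_rcons size_inv_coefs ltnn eqxx mulrA mulfV// mul1r.
rewrite [X in _ - X + _](_ : _ = \sum_(i < n) f i.+1 * (inv_coefs f (n - i.+1).+1)`_(n - i.+1)).
  by rewrite subrK.
by apply: eq_bigr => i _; rewrite nth_inv_coefs//; have := ltn_ord i; lia.
Qed.

Lemma laurent_inv_ex a : a != 0 -> exists b, b * a = 1.
Proof.
move=> /laurent_order[N [aN0 aN]].
pose f (i : nat) := a (N + i%:Z).
pose g t : F := if t < - N then 0 else (inv_coefs f `|t + N|.+1)`_`|t + N|.
have gN : vanishes_below (- N) g by move=> t tN; rewrite /g tN.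
have gb : exists M, vanishes_below M g by exists (- N).
have bN : vanishes_below (- N) (Laurent gb) by exact: gN.
exists (Laurent gb); rewrite mulrC; apply: laurentP => t.
have [t0|t0] := ltP t 0.
  by rewrite [LHS](lconv_lt aN bN) ?subrr//= lt_eqF.
have -> : t = `|t|%N%:Z by lia.
set n := `|t|%N; rewrite [LHS](lconvE (n := n.+1) aN bN); last lia.
have f0 : f 0%N != 0 by rewrite /f addr0.
rewrite [RHS](_ : _ = (n == 0%N)%:R) // -(inv_coefsP n f0).
apply: eq_bigr => i _; congr (_ * _); have := ltn_ord i => ilt.
rewrite /= /g ifF; last lia.
by rewrite (_ : absz (_ + N)%R = (n - i)%N); last lia.
Qed.

Definition linv a : laurent F :=
  if pselect (exists b, b * a = 1) is left e then projT1 (cid e) else 0.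

Lemma lmulV a : a != 0 -> linv a * a = 1.
Proof.
move=> /laurent_inv_ex h; rewrite /linv; case: pselect => // e.
exact: projT2 (cid e).
Qed.

Lemma linv0 : linv 0 = 0.
Proof.
rewrite /linv; case: pselect => // e; have [b] := e.
by rewrite mulr0 => /esym/eqP; rewrite oner_eq0.
Qed.

HB.instance Definition _ := GRing.ComNzRing_isField.Build (laurent F) lmulV linv0.

(* The series z, with coefficient 1 at z^(-(-1)). *)
Definition lz : laurent F := Laurent (lmono_bound (-1)).

Definition lval a : \bar int :=
  if a == 0 then +oo%E
  else (xget 0 [set i | a i != 0 /\ vanishes_below i a])%:E%E.

Lemma lpoly_bound (p : {poly F}) :
  exists N, vanishes_below N (fun t => if t <= 0 then p`_(absz t) else 0).
Proof.
exists (- (size p)%:Z) => t tp; case: ifP => // _.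
have pt : (size p <= absz t)%N by lia.
exact: nth_default.
Qed.

Definition lpoly (p : {poly F}) : laurent F := Laurent (lpoly_bound p).

(* The bound on the degree is irrelevant: see [coef_lfloor]. *)
Definition lfloor a : {poly F} :=
  \poly_(i < (absz (projT1 (cid (laurent_bound a)))).+1) a (- i%:Z).

Definition lfrac a : laurent F := a - lpoly (lfloor a).

Lemma coef_lfloor a (i : nat) : (lfloor a)`_i = a (- i%:Z).
Proof.
rewrite coef_poly; case: ltnP => //; case: cid => N /= aN iN.
by rewrite aN//; lia.
Qed.

End LaurentField.

Section ContinuedFractions.
Variables (F : fieldType) (n : nat).

(* The dimension m >= 1 is n.+1; the index set Z_m is 'I_n.+1, numbered from 0. *)
Local Notation m := n.+1.
Local Notation Lvec := 'cV[laurent F]_m.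
Local Notation Pvec := 'cV[{poly F}]_m.

Definition iv_lt (p q : 'I_m * \bar int) : bool :=
  (p.2 < q.2)%O || (p.2 == q.2) && (p.1 < q.1)%N.

Definition iv_le (p q : 'I_m * \bar int) : bool := iv_lt p q || (p == q).

Definition vval (r : Lvec) : \bar int :=
  \big[Order.min/+oo%E]_(i < m) lval (r i 0).

Definition vidx (r : Lvec) : 'I_m :=
  head ord0 [seq i <- enum 'I_m | lval (r i 0) == vval r].

Definition Iv (r : Lvec) : 'I_m * \bar int := (vidx r, vval r).

Definition vpoly (a : Pvec) : Lvec := map_mx (@lpoly F) a.
Definition vfloor (r : Lvec) : Pvec := map_mx (@lfloor F) r.
Definition vfrac (r : Lvec) : Lvec := map_mx (@lfrac F) r.

Definition monomial (x : int) (j : 'I_m) : Lvec := lz F ^ x *: delta_mx j 0.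

Definition monomials_of (r : Lvec) : set Lvec :=
  [set monomial p.1 p.2 | p in [set p : int * 'I_m | r p.2 0 (- p.1) != 0]].

(* The default value is taken only if there is no largest Iv, i.e., if r is 0
   or has infinitely many monomials. *)
Definition SuppPlus (r : Lvec) : 'I_m * \bar int :=
  xget (ord0, +oo%E)
    [set p | (exists2 u, monomials_of r u & p = Iv u) /\
             forall u, monomials_of r u -> iv_le (Iv u) p].

Definition Diagz (c : 'I_m -> int) : 'M[laurent F]_m :=
  diag_mx (\row_j lz F ^ (- c j)).

(* An m-pre-continued fraction is given by the sequence of the pairs
   (h_k, a_k), 1 <= k < omega: [CFfin s] has length omega = size s + 1 and
   [CFinf f] has length omega = oo. The pair (h_k, a_k) is stored at
   position k - 1, and a_0 = 0 is omitted. *)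
Inductive precf :=
  | CFfin of seq ('I_m * Pvec)
  | CFinf of nat -> 'I_m * Pvec.

(* k < omega *)
Definition lt_len (k : nat) (C : precf) : bool :=
  if C is CFfin s then (k < (size s).+1)%N else true.

(* (h_k, a_k); meaningless unless 1 <= k < omega *)
Definition digit (C : precf) (k : nat) : 'I_m * Pvec :=
  match C with
  | CFfin s => nth (ord0, 0) s k.-1
  | CFinf f => f k.-1
  end.

Definition cf_h C k : 'I_m := (digit C k).1.
Definition cf_a C k : Pvec := (digit C k).2.

Definition Emx (h : 'I_m) : 'M[{poly F}]_(m + 1) :=
  xcol (lshift 1 h) (rshift m ord0) 1%:M.

Definition Amx (a : Pvec) : 'M[{poly F}]_(m + 1) := block_mx 1%:M a 0 1%:M.

Fixpoint cf_B (C : precf) (k : nat) : 'M[{poly F}]_(m + 1) :=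
  if k is k'.+1 then cf_B C k' *m Emx (cf_h C k) *m Amx (cf_a C k) else 1%:M.

Definition cf_p C k : Pvec := ursubmx (cf_B C k).
Definition cf_q C k : {poly F} := drsubmx (cf_B C k) 0 0.

Definition convergent C k : Lvec := (lpoly (cf_q C k))^-1 *: vpoly (cf_p C k).

(* degree of the h_k-th entry of a_k, i.e., t_k under Condition 1 *)
Definition cf_t C k : nat := (size (cf_a C k (cf_h C k) 0)).-1.

Definition cf_v C k (j : 'I_m) : nat := (\sum_(1 <= i < k.+1 | cf_h C i == j) cf_t C i)%N.

Definition cf_D C k : 'M[laurent F]_m := Diagz (fun j => (cf_v C k j)%:Z).

(* (h_k, v_(k-1, h_k)) *)
Definition iv_before C k : 'I_m * \bar int := (cf_h C k, (cf_v C k.-1 (cf_h C k))%:Z%:E%E).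
(* (h_k, v_k) *)
Definition iv_after C k : 'I_m * \bar int := (cf_h C k, (cf_v C k (cf_h C k))%:Z%:E%E).

Definition cond1 C := forall k, (1 <= k)%N -> lt_len k C -> (1 <= cf_t C k)%N.

Definition cond2 C := forall k, (1 <= k)%N -> lt_len k.+1 C ->
  iv_lt (iv_before C k) (iv_after C k.+1).

Definition cond3 C := forall k, (1 <= k)%N -> lt_len k C ->
  Iv (cf_D C k *m vpoly (cf_a C k)) = iv_before C k.

Definition cond4 C := forall k, (1 <= k)%N -> lt_len k.+1 C ->
  iv_lt (SuppPlus (cf_D C k *m vpoly (cf_a C k))) (iv_after C k.+1).

Definition mCF C := [/\ cond1 C, cond2 C & cond3 C].

Definition strict_mCF C := mCF C /\ cond4 C.

Definition vcvg (u : nat -> Lvec) (r : Lvec) :=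
  forall N : int, exists K, forall k, (K <= k)%N -> (N%:E <= vval (r - u k)%R)%E.

(* The limit of the convergents exists for every m-continued fraction; the
   default value 0 is taken only by other pre-continued fractions. *)
Definition phi (C : precf) : Lvec :=
  match C with
  | CFfin s => convergent C (size s)
  | CFinf _ => xget 0 [set r | vcvg (convergent C) r]
  end.

Definition CFset (r : Lvec) : set precf := [set C | mCF C /\ phi C = r].

(* State of the m-CF transform after step k: the exponents c_k of
   Delta_(k-1) and the remainder beta_k. The next definitions describe
   step k + 1 from there. *)
Record state := State { st_c : 'I_m -> int ; st_beta : Lvec }.

Definition step_vec (s : state) : Lvec := Diagz (st_c s) *m st_beta s.

Definition step_h (s : state) : 'I_m := vidx (step_vec s).

(* vval is finite here when beta_k <> 0 *)
Definition step_c (s : state) (j : 'I_m) : int :=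
  if j == step_h s then fine (vval (step_vec s)) else st_c s j.

Definition step_rho (s : state) : Lvec :=
  \col_j if j == step_h s then (st_beta s (step_h s) 0)^-1
         else st_beta s j 0 / st_beta s (step_h s) 0.

Definition admissible (s : state) (e : Pvec) : bool :=
  iv_le (Iv (Diagz (step_c s) *m vfrac (step_rho s)))
        (Iv (Diagz (step_c s) *m vpoly e)).

Definition step_digit (s : state) (e : Pvec) : 'I_m * Pvec :=
  (step_h s, vfloor (step_rho s) - e).

Definition step (s : state) (e : Pvec) : state :=
  State (step_c s) (vfrac (step_rho s) + vpoly e).

(* The choice of epsilon_(k+1) is [eps k s] if s is the state after step k. *)
Definition strategy := nat -> state -> Pvec.

Fixpoint run (r : Lvec) (eps : strategy) (k : nat) : state :=
  if k is k'.+1 then step (run r eps k') (eps k' (run r eps k'))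
  else State (fun=> 0) r.

Definition output_digit r (eps : strategy) (k : nat) : 'I_m * Pvec :=
  step_digit (run r eps k) (eps k (run r eps k)).

(* [run] is continued after the procedure has stopped, but [output] ignores
   everything after the first k with beta_k = 0. *)
Definition output (r : Lvec) (eps : strategy) : precf :=
  if pselect (exists k, st_beta (run r eps k) == 0) is left stops then
    CFfin (mkseq (output_digit r eps) (ex_minn stops))
  else CFinf (output_digit r eps).

Definition admissible_for (r : Lvec) (eps : strategy) :=
  forall k, (forall i, (i <= k)%N -> st_beta (run r eps i) != 0) ->
    admissible (run r eps k) (eps k (run r eps k)).

Definition Tset (r : Lvec) : set precf :=
  [set output r eps | eps in admissible_for r].

(* The Delta-polynomial part of rho, for Delta = Diagz c. The term z^i e_j has
   coefficient (vfloor rho j 0)`_i in the polynomial part of rho. *)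
Definition Delta_floor (c : 'I_m -> int) (rho : Lvec) : Pvec :=
  \col_j \poly_(i < size (vfloor rho j 0))
    (if iv_lt (Iv (Diagz c *m monomial i%:Z j)) (Iv (Diagz c *m vfrac rho))
     then (vfloor rho j 0)`_i else 0).

Definition psi_strategy : strategy := fun _ s =>
  vfloor (step_rho s) - Delta_floor (step_c s) (step_rho s).

Definition psi (r : Lvec) : precf := output r psi_strategy.

Definition Sset : set Lvec := [set r | (0%E < vval r)%E].

Definition Cstar : set precf := [set C | strict_mCF C].

End ContinuedFractions.

Arguments Sset F n : clear implicits.
Arguments Cstar F n : clear implicits.

(* Main.v *)
(* Let beta_0 = r and beta_k be the remainders of the transform. An m-CF C has
   value r iff the remainders obtained from r with the digits of C satisfy
   Iv(Delta_(k-1) beta_k) = (h_(k+1), v_(k+1)), which is also what the transform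
   produces. In one direction, the column combination
   sum_j beta_(k,j) R_(k,j) + R_k = 0, where R is p - q r for the columns (p; q)
   of B_k, gives v(p_k - q_k r) >= v_(k+1); with deg q_k = t_1 + ... + t_k >= k
   this shows that the convergents tend to r. In the other one, the remainders
   of the truncations of C are computed backwards, their leading terms are given
   by Conditions 2 and 3, and the remainders of r are their limits. Finally
   Iv(Delta beta_k) = Iv(Delta {rho_k}), so that Condition 4 says that a_k
   consists exactly of the monomials kept by the Delta-polynomial part. *)

Require Import Defs.
From HB Require Import structures.
From mathcomp Require Import all_boot all_order all_algebra.
From mathcomp Require Import boolp classical_sets functions.
From mathcomp Require Import perm constructive_ereal zify.

Set Implicit Arguments.
Unset Strict Implicit.
Unset Printing Implicit Defensive.

Import Order.TTheory GRing.Theory Num.Theory.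

(** * Valuations of Laurent series *)

Section Valuation.
Local Open Scope ring_scope.
Variable F : fieldType.
Implicit Types (a b : laurent F) (N M t : int) (p q : {poly F}).

Lemma vanishes_belowW N M a : N <= M -> vanishes_below M a -> vanishes_below N a.
Proof. by move=> NM aM t tN; apply: aM; apply: lt_le_trans NM. Qed.

Lemma vanishes_belowS N a : vanishes_below N a -> a N = 0 ->
  vanishes_below (N + 1) a.
Proof.
move=> aN a0 t tN; have [->//|tN'] := eqVneq t N; apply: aN; lia.
Qed.

Lemma vanishes_belowD N a b :
  vanishes_below N a -> vanishes_below N b -> vanishes_below N (a + b).
Proof. by move=> aN bN t tN /=; rewrite aN ?bN ?addr0. Qed.

Lemma vanishes_belowN N a : vanishes_below N a -> vanishes_below N (- a).
Proof. by move=> aN t tN /=; rewrite aN ?oppr0. Qed.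

Lemma vanishes_belowB N a b :
  vanishes_below N a -> vanishes_below N b -> vanishes_below N (a - b).
Proof. by move=> aN bN; apply: vanishes_belowD => //; apply: vanishes_belowN. Qed.

Lemma vanishes_below_sum N (I : Type) (s : seq I) (P : pred I)
    (f : I -> laurent F) :
  (forall i, P i -> vanishes_below N (f i)) ->
  vanishes_below N (\sum_(i <- s | P i) f i).
Proof.
move=> fN; elim/big_ind : _ => //; exact: vanishes_belowD.
Qed.

Lemma vanishes_belowM N M a b :
  vanishes_below N a -> vanishes_below M b -> vanishes_below (N + M) (a * b).
Proof. by move=> aN bM t; apply: lconv_lt. Qed.

Lemma lcoefM_low N M a b : vanishes_below N a -> vanishes_below M b ->
  (a * b) (N + M) = a N * b M.
Proof.
move=> aN bM; rewrite [LHS](lconvE (n := 1%N) aN bM); last lia.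
by rewrite big_ord1 addr0 subr0 addrC addKr.
Qed.

Lemma lcoefD a b t : (a + b) t = a t + b t. Proof. by []. Qed.
Lemma lcoefB a b t : (a - b) t = a t - b t. Proof. by []. Qed.

Lemma laurent_neq0 a t : a t != 0 -> a != 0.
Proof. by apply: contra_neq => ->. Qed.

Lemma lcoef1 t : (1 : laurent F) t = (t == 0)%:R. Proof. by []. Qed.

(** If M is the order of the inverse, the product has a nonzero coefficient at [N + M]; the product
    is 1, so [N + M] is 0. *)
Lemma laurent_inv_low N a : vanishes_below N a -> a N != 0 ->
  vanishes_below (- N) (a^-1)%R /\ a^-1 (- N) != 0.
Proof.
move=> aN aN0; have a0 := laurent_neq0 aN0.
have /laurent_order[M [bM0 bM]] : a^-1 != 0 by rewrite invr_eq0.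
have h : (a * a^-1) (N + M) != 0 by rewrite lcoefM_low ?mulf_neq0.
suff -> : - N = M by [].
by move: h; rewrite divff// lcoef1; case: (N + M =P 0) => [|_]; [lia|rewrite eqxx].
Qed.

Lemma vanishes_below_all a : (forall N, vanishes_below N a) -> a = 0.
Proof. by move=> h; apply: laurentP => t; apply: (h (t + 1)); lia. Qed.


(** * Single-term series and powers of z *)

Fact lmonom_bound c N : exists M, vanishes_below M (fun t => if t == N then c else 0 : F).
Proof. by exists N => t tN; rewrite lt_eqF. Qed.

(** The series c z^(-N). Multiplying by it only shifts and scales coefficients, so identities with
    powers of z and constants become index computations. *)
Definition lmonom c N : laurent F := Laurent (lmonom_bound c N).

Lemma lcoef_lmonomM c N a t : (lmonom c N * a) t = c * a (t - N).
Proof.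
have [M aM] := laurent_bound a.
have cN : vanishes_below N (lmonom c N) by move=> u uN /=; rewrite lt_eqF.
rewrite [LHS](lconvE (n := (absz (t - N - M)%R).+1) cN aM); last lia.
rewrite big_ord_recl /= addr0 eqxx subr0 big1 ?addr0// => i _.
by rewrite /bump ifF ?mul0r//; lia.
Qed.

Lemma lmonomM c d N M : lmonom c N * lmonom d M = lmonom (c * d) (N + M).
Proof.
apply: laurentP => t; rewrite lcoef_lmonomM /=.
by rewrite (fun_if ( *%R c)) mulr0; congr (if _ then _ else _); lia.
Qed.

Lemma lz_expz N : lz F ^ N = lmonom 1 (- N).
Proof.
have zE : lz F = lmonom 1 (-1) by apply: laurentP => t /=; case: eqP.
have oE : 1 = lmonom 1 0 by apply: laurentP => t /=; case: eqP.
have pE (k : nat) : lz F ^+ k = lmonom 1 (- k%:Z).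
  elim: k => [|k IHk]; first by rewrite expr0 oppr0.
  by rewrite exprS IHk {1}zE lmonomM mulr1; congr lmonom; lia.
case: N => k; first exact: pE.
rewrite NegzE -exprnN pE; apply: (mulIf (x := lmonom 1 (- k.+1%:Z))).
  by apply: (@laurent_neq0 _ (- k.+1%:Z)); rewrite /= eqxx oner_eq0.
rewrite mulVf ?lmonomM ?mulr1 ?opprK ?subrr//.
by apply: (@laurent_neq0 _ (- k.+1%:Z)); rewrite /= eqxx oner_eq0.
Qed.

Lemma lcoef_lz_expzM N a t : (lz F ^ N * a) t = a (t + N).
Proof. by rewrite lz_expz lcoef_lmonomM mul1r opprK. Qed.

(** * Polynomials as series; polynomial and fractional parts *)

Lemma lpolyE p t : lpoly p t = if t <= 0 then p`_(absz t) else 0.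
Proof. by []. Qed.

Fact lpoly_is_zmod_morphism : zmod_morphism (@lpoly F).
Proof.
by move=> p q; apply: laurentP => t /=; case: ifP; rewrite ?coefB ?subrr.
Qed.

HB.instance Definition _ := GRing.isZmodMorphism.Build _ _ (@lpoly F)
  lpoly_is_zmod_morphism.

Lemma lpolyC c : lpoly c%:P = lmonom c 0.
Proof.
apply: laurentP => t /=; rewrite coefC; case: ifP => t0.
  by congr (if _ then _ else _); lia.
by rewrite ifF//; lia.
Qed.

Lemma lpolyCM c p : lpoly (c%:P * p) = lpoly c%:P * lpoly p.
Proof.
apply: laurentP => t; rewrite lpolyC lcoef_lmonomM subr0 !lpolyE coefCM.
by case: ifP; rewrite ?mulr0.
Qed.

Lemma lpolyXM p : lpoly ('X * p) = lz F * lpoly p.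
Proof.
apply: laurentP => t; rewrite -[lz F]expr1z lcoef_lz_expzM !lpolyE coefXM.
have [t1|t1] := leP (t + 1) 0.
  rewrite ifT; last lia; rewrite ifF; last lia.
  by congr (p`_ _); lia.
case: ifP => // t0; rewrite ifT//; lia.
Qed.

(** Horner induction on the first factor: only products with a constant and with X have to be
    checked, a scaling and a shift of coefficients. *)
Fact lpoly_is_monoid_morphism : monoid_morphism (@lpoly F).
Proof.
split; first by rewrite -[1]/(1%:P) lpolyC; apply: laurentP => t /=; case: eqP.
move=> p q; elim/poly_ind: p => [|p c IHp]; first by rewrite mul0r !raddf0 mul0r.
rewrite mulrDl !raddfD /= lpolyCM mulrDl; congr (_ + _).
by rewrite [p * 'X]mulrC -mulrA !lpolyXM IHp mulrA.
Qed.

HB.instance Definition _ := GRing.isMonoidMorphism.Build _ _ (@lpoly F)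
  lpoly_is_monoid_morphism.

Lemma lpoly_gt0 p t : 0 < t -> lpoly p t = 0.
Proof. by move=> t0; rewrite lpolyE ifF//; lia. Qed.

Lemma lfracE a t : lfrac a t = if t <= 0 then 0 else a t.
Proof.
rewrite /lfrac lcoefB lpolyE coef_lfloor; case: ifP => t0; rewrite ?subr0//.
by rewrite (_ : - _ = t) ?subrr//; lia.
Qed.

Lemma lfracK a : lpoly (lfloor a) + lfrac a = a.
Proof. by rewrite /lfrac addrC subrK. Qed.

Lemma vanishes_below_lfrac N a : vanishes_below N a -> vanishes_below N (lfrac a).
Proof. by move=> aN t tN; rewrite lfracE aN// if_same. Qed.

Lemma lfrac_gt0 a : vanishes_below 1 (lfrac a).
Proof. by move=> t t0; rewrite lfracE ifT//; lia. Qed.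

Lemma lfloorE p a : vanishes_below 1 a -> lfloor (lpoly p + a) = p.
Proof.
move=> a1; apply/polyP => i; rewrite coef_lfloor lcoefD lpolyE ifT; last lia.
by rewrite a1 ?addr0 ?abszN//; lia.
Qed.

(** Reads a degree off the order of the series; this identifies the degree of a digit with the
    exponent added by the transform. *)
Lemma size_lpoly p (k : nat) : vanishes_below (- k%:Z) (lpoly p) ->
  lpoly p (- k%:Z) != 0 -> size p = k.+1.
Proof.
move=> pk; rewrite lpolyE ifT ?abszN ?absz_nat; last lia.
move=> pk0; apply/eqP; rewrite eqn_leq; apply/andP; split; last first.
  by rewrite ltnNge; apply: contraNN pk0 => /(nth_default 0)->.
apply/leq_sizeP => i ki.
have := pk (- i%:Z); rewrite lpolyE ifT ?abszN; last lia.
by apply; lia.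
Qed.

(** [lval] picks an order by choice; two orders of one series coincide, since the coefficient at the
    smaller one would vanish. *)
Lemma lvalP N a : vanishes_below N a -> a N != 0 -> lval a = N%:E%E.
Proof.
move=> aN aN0; rewrite /lval (negbTE (laurent_neq0 aN0)).
have : [set i | a i != 0 /\ vanishes_below i a]%classic N by split.
move=> /(xgetI 0)[x0 xv]; congr (_%:E)%E; set x := xget _ _ in x0 xv *.
have [xN|Nx|//] := ltgtP x N.
- by rewrite aN ?eqxx in x0.
- by rewrite xv ?eqxx in aN0.
Qed.

Lemma lval_ge N a : (N%:E <= lval a)%E <-> vanishes_below N a.
Proof.
have [->|a0] := eqVneq a 0.
  by rewrite /lval eqxx leey; split.
have [i [ai av]] := laurent_order a0.
rewrite (lvalP av ai) lee_fin; split=> [Ni|aN]; first exact: vanishes_belowW av.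
by rewrite leNgt; apply: contraNN ai => /aN ->.
Qed.

Lemma lval_cases a : a = 0 /\ lval a = +oo%E \/
  exists i, [/\ vanishes_below i a, a i != 0 & lval a = i%:E%E].
Proof.
have [->|a0] := eqVneq a 0; first by left; rewrite /lval eqxx.
have [i [ai av]] := laurent_order a0; right; exists i; split=> //.
exact: lvalP.
Qed.

End Valuation.

Arguments lcoef : simpl never.
Arguments cf_B : simpl never.

(** * Leading monomials *)

Section WeightedIv.
Local Open Scope ring_scope.
Variables (F : fieldType) (n : nat).
Local Notation m := n.+1.
Local Notation Lvec := 'cV[laurent F]_m.
Local Notation Pvec := 'cV[{poly F}]_m.
Implicit Types (r : Lvec) (c : 'I_m -> int) (h j : 'I_m) (v t : int).
Implicit Types p q : 'I_m * \bar int.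

Lemma lcoef_Diagz c r j t : (Diagz F c *m r) j 0 t = r j 0 (t - c j).
Proof. by rewrite /Diagz mul_diag_mx !mxE lcoef_lz_expzM. Qed.

Lemma iv_ltNge p q : iv_lt p q = ~~ iv_le q p.
Proof.
case: p q => [i x] [j y]; rewrite /iv_le /iv_lt /= xpair_eqE.
case: (ltgtP x y) => //= _; rewrite ?andbF ?andbT//=.
by rewrite -val_eqE /=; case: ltngtP.
Qed.

Lemma iv_lt_le_trans p q s : iv_lt p q -> iv_le q s -> iv_lt p s.
Proof.
move=> pq /orP[|/eqP<-//]; move: pq; case: p q s => [i x] [j y] [k z].
rewrite /iv_lt /= => /orP[xy|/andP[/eqP-> ij]] /orP[yz|/andP[/eqP<- jk]].
- by rewrite (lt_trans xy yz).
- by rewrite xy.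
- by rewrite yz.
- by rewrite eqxx (ltn_trans ij jk) orbT.
Qed.

Lemma iv_le_lt_trans p q s : iv_le p q -> iv_lt q s -> iv_lt p s.
Proof.
by move=> /orP[|/eqP->//] pq qs; apply: iv_lt_le_trans pq _; rewrite /iv_le qs.
Qed.

Lemma iv_lt_le p q : iv_lt p q -> iv_le p q.
Proof. by rewrite /iv_le => ->. Qed.

Lemma iv_le_refl p : iv_le p p.
Proof. by rewrite /iv_le eqxx orbT. Qed.

Lemma iv_le_trans p q s : iv_le p q -> iv_le q s -> iv_le p s.
Proof.
by move=> /orP[pq qs|/eqP->//]; apply: iv_lt_le; apply: iv_lt_le_trans qs.
Qed.

Lemma iv_lt_fin h v j w :
  iv_lt (h, v%:E%E) (j, w%:E%E) = (v < w) || (v == w) && (h < j)%N.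
Proof. by rewrite /iv_lt /= lte_fin eqe. Qed.

Lemma iv_lt_top h v j : iv_lt (h, v%:E%E) (j, +oo%E).
Proof. by rewrite /iv_lt /= ltey. Qed.

Lemma iv_lt_ltop h j v : iv_lt (h, +oo%E) (j, v%:E%E) = false.
Proof. by []. Qed.

(* Coefficientwise forms of (h, v) <= Iv (Diagz F c *m r) and of its strict
   version; the tie-breaking rule on indices becomes the summand 0 or 1. *)
Definition wge c r h v :=
  forall j, vanishes_below (v + (j < h)%N%:Z - c j) (r j 0).
Definition wgt c r h v :=
  forall j, vanishes_below (v + (j <= h)%N%:Z - c j) (r j 0).

Lemma wgtW c r h v : wgt c r h v -> wge c r h v.
Proof. by move=> H j; apply: vanishes_belowW (H j); case: (ltngtP j h); lia. Qed.

Lemma wge_lt c r h v j w : wge c r j w -> iv_lt (h, v%:E%E) (j, w%:E%E) ->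
  wgt c r h v.
Proof.
rewrite iv_lt_fin => H vw i; apply: vanishes_belowW (H i).
have : v + (i <= h)%N%:Z <= w + (i < j)%N%:Z; last lia.
case/orP: vw => [vw|/andP[/eqP-> hj]]; first by case: leqP; case: leqP; lia.
by case: leqP; case: leqP; lia.
Qed.

Lemma wgeD c r s h v : wge c r h v -> wge c s h v -> wge c (r + s) h v.
Proof. by move=> rv sv j; rewrite mxE; apply: vanishes_belowD. Qed.

Lemma wgtD c r s h v : wgt c r h v -> wgt c s h v -> wgt c (r + s) h v.
Proof. by move=> rv sv j; rewrite mxE; apply: vanishes_belowD. Qed.

Lemma wgtN c r h v : wgt c r h v -> wgt c (- r) h v.
Proof. by move=> rv j; rewrite mxE; apply: vanishes_belowN. Qed.

Lemma wgt0 c h v : wgt c 0 h v.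
Proof. by move=> j; rewrite mxE. Qed.

Lemma vval_ge r v : (v%:E <= vval r)%E <-> forall j, vanishes_below v (r j 0).
Proof.
split=> [/bigmin_geP[_ h] j|h]; first by apply/lval_ge; exact: h.
by apply/bigmin_geP; split=> [|j _]; [rewrite leey|apply/lval_ge; exact: h].
Qed.

Lemma vvalP r h v : (forall j, vanishes_below v (r j 0)) -> r h 0 v != 0 ->
  vval r = v%:E%E.
Proof.
move=> H rh; apply/eqP; rewrite eq_le; apply/andP; split; last exact/vval_ge.
by rewrite -(lvalP (H h) rh); apply: bigmin_le.
Qed.

Lemma vval0 : vval (0 : Lvec) = +oo%E.
Proof.
apply/eqP; rewrite -leye_eq; apply/bigmin_geP; split=> // j _.
by rewrite mxE /lval eqxx.
Qed.

(** [vidx] is the head of a filtered enumeration of the indices; this list is increasing, so its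
    head is the least index of minimal valuation. *)
Lemma vidxP r h : lval (r h 0) = vval r ->
  (forall j, (j < h)%N -> lval (r j 0) != vval r) -> vidx r = h.
Proof.
move=> rh rj; rewrite /vidx; set s := filter _ _.
have hs : h \in s by rewrite mem_filter rh eqxx mem_enum.
have : sorted (relpre val ltn) s.
  apply: sorted_filter; first by move=> ? ? ?; apply: ltn_trans.
  by rewrite -sorted_map val_enum_ord iota_ltn_sorted.
have : {in s, forall i, lval (r i 0) == vval r}.
  by move=> i; rewrite mem_filter => /andP[].
case: s hs => //= i s; rewrite inE => /orP[/eqP->//|hs] H ps.
have /allP/(_ _ hs)/= ih : all (relpre val ltn i) s.
  by apply: order_path_min ps => ? ? ?; apply: ltn_trans.
by have := rj _ ih; rewrite H ?mem_head.
Qed.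

Lemma Iv0 : Iv (0 : Lvec) = (ord0, +oo%E).
Proof.
by rewrite /Iv vval0 (@vidxP _ ord0)//; rewrite mxE /lval eqxx vval0.
Qed.

(** The summand 1 in [wge] pushes the indices below h beyond v, so h is the first index that attains
    the minimum. *)
Lemma IvP c r h v : wge c r h v -> r h 0 (v - c h) != 0 ->
  Iv (Diagz F c *m r) = (h, v%:E%E).
Proof.
move=> H rh.
have H' j : vanishes_below (v + (j < h)%N%:Z) ((Diagz F c *m r) j 0).
  by move=> t tv; rewrite lcoef_Diagz H//; lia.
have H0 j : vanishes_below v ((Diagz F c *m r) j 0).
  by apply: vanishes_belowW (H' j); lia.
have rh' : (Diagz F c *m r) h 0 v != 0 by rewrite lcoef_Diagz.
rewrite /Iv (vvalP H0 rh'); congr (_, _); apply: vidxP.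
  by rewrite (vvalP H0 rh'); apply: lvalP.
move=> j jh; rewrite (vvalP H0 rh'); apply: contraTneq isT => E.
have /lval_ge : vanishes_below (v + 1) ((Diagz F c *m r) j 0).
  by have := H' j; rewrite jh.
by rewrite E lee_fin; lia.
Qed.

Lemma Diagz_eq0 c r : (Diagz F c *m r == 0) = (r == 0).
Proof.
apply/eqP/eqP => [H|->]; last exact: mulmx0.
apply/colP => j; apply: laurentP => t.
have /colP/(_ j)/(congr1 (fun a => lcoef a (t + c j))) := H.
by rewrite lcoef_Diagz addrK !mxE.
Qed.

Lemma Iv_cases c r :
  r = 0 /\ Iv (Diagz F c *m r) = (ord0, +oo%E) \/
  exists h v, [/\ wge c r h v, r h 0 (v - c h) != 0 &
                  Iv (Diagz F c *m r) = (h, v%:E%E)].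
Proof.
have [->|r0] := eqVneq r 0; first by left; rewrite mulmx0 Iv0.
right; set s := Diagz F c *m r.
(* An entry of minimal valuation; were it 0, all valuations would be infinite and r would be 0. *)
have [j0 _ jmin] : exists2 j : 'I_m, true & forall i, (lval (s j 0%R) <= lval (s i 0%R))%E.
  exists [arg min_(j < ord0) lval (s j 0%R)]%O => //.
  by case: arg_minP => //= j _ jmin i; exact: jmin.
have s0 : s j0 0 != 0.
  apply/eqP => sj0; move: jmin; rewrite sj0 /(lval 0) eqxx => jmin.
  move/eqP: r0; apply; apply/eqP; rewrite -(Diagz_eq0 c) -/s; apply/eqP/colP => i.
  rewrite [RHS]mxE; have := jmin i; rewrite leye_eq.
  by case: (lval_cases (s i 0)) => [[-> //]|[k [_ _ ->]]].
case: (lval_cases (s j0 0)) => [[/eqP]|[v [sv svn vE]]]; first by rewrite (negbTE s0).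
rewrite vE in jmin.
(* The least index among the entries of minimal valuation is the wanted h. *)
have exv : exists i : nat, [exists j : 'I_m, (j == i :> nat) && (lval (s j 0) == v%:E%E)].
  by exists j0; apply/existsP; exists j0; rewrite vE !eqxx.
case: (ex_minnP exv) => k /existsP[h /andP[/eqP<- /eqP hv] hmin] {k}.
have H : wge c r h v.
  move=> j t tv; have -> : t = t + c j - c j by lia.
  rewrite -lcoef_Diagz -/s.
  case: (ltnP j h) tv => jh tv; last first.
    by have /lval_ge := jmin j; apply; lia.
  have : lval (s j 0) != v%:E%E.
    apply: contraTneq jh => E; rewrite -leqNgt; apply: hmin.
    by apply/existsP; exists j; rewrite E !eqxx.
  have := jmin j; case: (lval_cases (s j 0)) => [[-> //]|[k [kv kn ->]]].
  by rewrite lee_fin eqe => vk kv'; apply: kv; lia.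
have rn : r h 0 (v - c h) != 0.
  rewrite -lcoef_Diagz -/s; case: (lval_cases (s h 0)) => [[_]|[k [kv kn kE]]].
    by rewrite hv.
  by move: kE; rewrite hv => -[->].
by exists h, v; split=> //; apply: IvP.
Qed.

Lemma Iv_finP c r h v : Iv (Diagz F c *m r) = (h, v%:E%E) ->
  wge c r h v /\ r h 0 (v - c h) != 0.
Proof.
by case: (Iv_cases c r) => [[_ ->//]|[j [w [H ? ->]]]] [<- <-].
Qed.

Lemma iv_lt_wgt c r h v : iv_lt (h, v%:E%E) (Iv (Diagz F c *m r)) -> wgt c r h v.
Proof.
case: (Iv_cases c r) => [[-> _] _|[j [w [H _ ->]]]]; first exact: wgt0.
exact: wge_lt.
Qed.

Lemma wgt_iv_lt c r h v : wgt c r h v -> iv_lt (h, v%:E%E) (Iv (Diagz F c *m r)).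
Proof.
move=> H; case: (Iv_cases c r) => [[_ ->]|[j [w [_ rj ->]]]].
  exact: iv_lt_top.
rewrite iv_lt_fin; have := contra_neqN (fun lt => H j _ lt) rj.
by rewrite -leNgt; case: leqP; lia.
Qed.

Lemma iv_le_wge c r h v : iv_le (h, v%:E%E) (Iv (Diagz F c *m r)) -> wge c r h v.
Proof.
move=> /orP[/iv_lt_wgt/wgtW//|/eqP/esym/Iv_finP[//]].
Qed.

Lemma wge_iv_le c r h v : wge c r h v -> iv_le (h, v%:E%E) (Iv (Diagz F c *m r)).
Proof.
(* If the coefficient at the bound itself vanishes, the weak bound sharpens to the strict one. *)
move=> H; have [rh|rh] := eqVneq (r h 0 (v - c h)) 0; last first.
  by rewrite (IvP H rh) iv_le_refl.
apply/iv_lt_le/wgt_iv_lt => j; have [->|jh] := eqVneq j h.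
  rewrite leqnn; have := H h; rewrite ltnn addr0 => Hh.
  by apply: vanishes_belowW (vanishes_belowS Hh rh); lia.
by apply: vanishes_belowW (H j); move: jh; rewrite -val_eqE /=; lia.
Qed.

End WeightedIv.

(** * The inversion that leads from beta_(k-1) to rho_k *)

Section Inversion.
Local Open Scope ring_scope.
Variables (F : fieldType) (n : nat).
Local Notation m := n.+1.
Local Notation Lvec := 'cV[laurent F]_m.
Local Notation Pvec := 'cV[{poly F}]_m.
Implicit Types (r : Lvec) (c : 'I_m -> int) (h j : 'I_m) (v t : int).

(* An involution where r h 0 != 0: it is also the step from rho_k to beta_(k-1). *)
Definition rho h r : Lvec :=
  \col_j if j == h then (r h 0)^-1 else r j 0 / r h 0.

Lemma rhoK h r : r h 0 != 0 -> rho h (rho h r) = r.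
Proof.
move=> rh; apply/colP => j; rewrite !mxE eqxx invrK.
by case: eqVneq => [->//|_]; rewrite divfK.
Qed.

(** Division by the h-th entry lowers every bound by t, so [c' h] becomes [c h]; at h itself the
    inverse has order -t, which is [c h - c' h]. *)
Lemma rho_wge c c' h r t : c' h = c h + t -> (forall j, j != h -> c' j = c j) ->
  wge c r h (c' h) -> r h 0 t != 0 ->
  wge c' (rho h r) h (c h) /\ rho h r h 0 (- t) != 0.
Proof.
move=> ch cj H rh.
have rht : vanishes_below t (r h 0) by apply: vanishes_belowW (H h); lia.
have [it it0] := laurent_inv_low rht rh.
split=> [j|]; rewrite mxE ?eqxx//.
case: eqVneq => [->|jh]; first by apply: vanishes_belowW it; lia.
apply: vanishes_belowW (vanishes_belowM (H j) it); rewrite cj//; lia.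
Qed.

Lemma vpoly_eq (a : Pvec) j : vpoly a j 0 = lpoly (a j 0).
Proof. by rewrite mxE. Qed.

Lemma vpolyB (a b : Pvec) : vpoly (a - b) = vpoly a - vpoly b.
Proof. by apply/colP => j; rewrite !mxE raddfB. Qed.

Lemma vpoly0 : vpoly (0 : Pvec) = 0.
Proof. by apply/colP => j; rewrite !mxE raddf0. Qed.

Lemma vfracK r : vpoly (vfloor r) + vfrac r = r.
Proof. by apply/colP => j; rewrite !mxE lfracK. Qed.

End Inversion.

(** * Convergents *)

Section Convergents.
Local Open Scope ring_scope.
Variables (F : fieldType) (n : nat).
Local Notation m := n.+1.
Local Notation Lvec := 'cV[laurent F]_m.
Local Notation Pvec := 'cV[{poly F}]_m.
Implicit Types (C : precf F n) (r : Lvec) (h j : 'I_m) (k : nat).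

Local Notation last := (rshift m (@ord0 0)).

Definition cv C k j : int := (cf_v C k j)%:Z.
Definition cf_s C k : nat := (\sum_(1 <= i < k.+1) cf_t C i)%N.

Lemma lt_lenW k l C : (k <= l)%N -> lt_len l C -> lt_len k C.
Proof. by case: C => //= s kl; apply: leq_ltn_trans. Qed.

Lemma cv0 C j : cv C 0 j = 0.
Proof. by rewrite /cv /cf_v big_geq. Qed.

Lemma cvS C k : cv C k.+1 (cf_h C k.+1) = cv C k (cf_h C k.+1) + (cf_t C k.+1)%:Z.
Proof. by rewrite /cv /cf_v big_mkcond big_nat_recr//= -big_mkcond eqxx PoszD. Qed.

Lemma cvS_neq C k j : j != cf_h C k.+1 -> cv C k.+1 j = cv C k j.
Proof.
rewrite /cv /cf_v eq_sym => /negbTE hj.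
by rewrite big_mkcond big_nat_recr//= -big_mkcond hj addn0.
Qed.

Lemma cv_ge0 C k j : 0 <= cv C k j. Proof. by []. Qed.

Lemma cf_s0 C : cf_s C 0 = 0%N. Proof. by rewrite /cf_s big_geq. Qed.

Lemma cf_sS C k : cf_s C k.+1 = (cf_s C k + cf_t C k.+1)%N.
Proof. by rewrite /cf_s big_nat_recr. Qed.

Lemma cv_le_s C k j : cv C k j <= (cf_s C k)%:Z.
Proof.
rewrite /cv lez_nat /cf_v /cf_s big_mkcond; apply: leq_sum => i _.
by case: ifP.
Qed.

Lemma cf_B0 C (i j : 'I_(m + 1)) : cf_B C 0 i j = (i == j)%:R.
Proof. by rewrite mxE. Qed.

Lemma Emx_mul (A : 'M[{poly F}]_(m + 1)) h (i j : 'I_(m + 1)) :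
  (A *m Emx F h) i j = A i (tperm (lshift 1 h) last j).
Proof.
by rewrite /Emx xcolE mulmxA mulmx1 -xcolE mxE.
Qed.

Lemma tperm_lshift h j :
  tperm (lshift 1 h) last (lshift 1 j) = if j == h then last else lshift 1 j.
Proof.
case: eqVneq => [->|jh]; first exact: tpermL.
by rewrite tpermD// ?eq_rlshift// eq_lshift eq_sym.
Qed.

(** E_h exchanges column h with the last one, and A(a) leaves the first m columns as they are. *)
Lemma cf_BS C k i j : cf_B C k.+1 i (lshift 1 j) =
  if j == cf_h C k.+1 then cf_B C k i last else cf_B C k i (lshift 1 j).
Proof.
rewrite -[LHS]/((cf_B C k *m _ *m _) _ _) -[cf_B C k *m _]hsubmxK /Amx.
rewrite mul_row_block mulmx0 addr0 mulmx1.
rewrite row_mxEl mxE Emx_mul tperm_lshift; by case: ifP.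
Qed.

(** After the exchange the last column is the old column h; A(a) adds to it the first m new columns
    with the entries of a as coefficients. *)
Lemma cf_BS_last C k i : cf_B C k.+1 i last =
  cf_B C k i (lshift 1 (cf_h C k.+1)) +
  \sum_j cf_B C k.+1 i (lshift 1 j) * cf_a C k.+1 j 0.
Proof.
rewrite -[LHS]/((cf_B C k *m _ *m _) _ _) -[cf_B C k *m _]hsubmxK /Amx.
rewrite mul_row_block mulmx0 addr0 mulmx1.
rewrite row_mxEr mxE mulmx1 addrC mxE Emx_mul tpermR mxE; congr (_ + _).
by apply: eq_bigr => j _; rewrite mxE Emx_mul tperm_lshift cf_BS; case: ifP.
Qed.

End Convergents.

(** * The residuals p - q r of the columns of B_k *)

Section Approximation.
Local Open Scope ring_scope.
Variables (F : fieldType) (n : nat).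
Local Notation m := n.+1.
Local Notation Lvec := 'cV[laurent F]_m.
Local Notation Pvec := 'cV[{poly F}]_m.
Implicit Types (C : precf F n) (r : Lvec) (h j : 'I_m) (k : nat) (beta : nat -> Lvec).

Local Notation last := (rshift m (@ord0 0)).

(* beta_k has the leading term, and beta_(k+1) the value, which they would have
   if C were produced by the transform from beta_0. *)
Definition tail_at C beta k :=
  let h := cf_h C k.+1 in
  [/\ wge (cv C k) (beta k) h (cv C k.+1 h),
      beta k h 0 (cf_t C k.+1)%:Z != 0 &
      vpoly (cf_a C k.+1) + beta k.+1 = rho h (beta k)].

(** Linear in the column of B_k, hence subject to the same recursions as the columns. *)
Definition resid C r k i (l : 'I_(m + 1)) : laurent F :=
  lpoly (cf_B C k (lshift 1 i) l) - lpoly (cf_B C k last l) * r i 0.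

Lemma residS C r k i j : resid C r k.+1 i (lshift 1 j) =
  if j == cf_h C k.+1 then resid C r k i last else resid C r k i (lshift 1 j).
Proof. by rewrite /resid !cf_BS; case: ifP. Qed.

Lemma residS_last C r k i : resid C r k.+1 i last =
  resid C r k i (lshift 1 (cf_h C k.+1)) +
  \sum_j resid C r k.+1 i (lshift 1 j) * vpoly (cf_a C k.+1) j 0.
Proof.
rewrite /resid !cf_BS_last !rmorphD !rmorph_sum /= mulrDl opprD addrACA.
congr (_ + _); rewrite mulr_suml -sumrB; apply: eq_bigr => j _.
by rewrite !rmorphM /= vpoly_eq mulrBl mulrAC.
Qed.

(** E_h A(a) sends (beta_(k+1); 1) to a multiple of (beta_k; 1). Hence B_k sends (beta_k; 1) to a
    multiple of (beta_0; 1), on which p - q beta_0 vanishes. *)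
Lemma resid_sum C beta k i : (forall l, (l < k)%N -> tail_at C beta l) ->
  \sum_j resid C (beta 0%N) k i (lshift 1 j) * beta k j 0 +
  resid C (beta 0%N) k i last = 0.
Proof.
elim: k => [|k IHk] H.
  rewrite /resid !cf_B0 (bigD1 i) //= !cf_B0 !eqxx !eq_lrshift !eq_rlshift.
  rewrite big1 ?addr0 => [|j /negbTE ji].
    by rewrite !raddf0 rmorph1 !mul0r subr0 !mul1r add0r subrr.
  by rewrite !cf_B0 eq_lshift eq_sym ji eq_rlshift !raddf0 !mul0r subr0 mul0r.
have [_ bh E] := H k (ltnSn k); set h := cf_h C k.+1 in bh E.
(* The coefficients a_(k+1,j) of the last column join beta_(k+1,j) to form rho_(k+1,j). *)
rewrite residS_last -/h addrCA -big_split /=.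
under eq_bigr => j _.
  rewrite -mulrDr [_ j 0 + _]addrC (_ : _ + _ = rho h (beta k) j 0); last first.
    by rewrite -E !mxE.
over.
have b0 := laurent_neq0 bh.
rewrite (bigD1 h) //= residS eqxx mxE eqxx.
under eq_bigr => j jh do rewrite residS (negbTE jh) mxE (negbTE jh) mulrA.
have := IHk (fun l lk => H l (ltnW lk)); rewrite (bigD1 h) //= => IH.
(* Multiplying by beta_(k,h) clears the denominators of rho and leaves the relation for k. *)
rewrite -mulr_suml; apply: (mulIf b0); rewrite mul0r mulrDl [X in _ + X]mulrDl.
by rewrite !divfK// -[RHS]IH addrA addrAC.
Qed.

(** Only column h changes: it becomes the last column of B_k, which [resid_sum] expresses by the
    others with coefficients -beta_(k,j). Term j has order at least v_(k,j) + (v_(k+1) -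
    v_(k,j)). *)
Lemma resid_below C beta k i : (forall l, (l < k)%N -> tail_at C beta l) ->
  forall j, vanishes_below (cv C k j) (resid C (beta 0%N) k i (lshift 1 j)).
Proof.
elim: k => [|k IHk] H j.
  rewrite /resid !cf_B0 eq_lshift eq_rlshift raddf0 mul0r subr0 cv0.
  by case: (i == j); rewrite ?rmorph1 ?raddf0 => // t t0; rewrite lcoef1 lt_eqF.
have IH := IHk (fun l lk => H l (ltnW lk)).
rewrite residS; case: eqVneq => [->|jh]; last by rewrite cvS_neq.
have [bw _ _] := H k (ltnSn k).
have /eqP := resid_sum i (fun l (lk : (l < k)%N) => H l (ltnW lk)).
rewrite addrC addr_eq0 => /eqP->; apply/vanishes_belowN/vanishes_below_sum => l _.
by apply: vanishes_belowW (vanishes_belowM (IH l) (bw l)); lia.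
Qed.

Lemma resid_last_below C beta k i : (forall l, (l <= k)%N -> tail_at C beta l) ->
  vanishes_below (cv C k.+1 (cf_h C k.+1)) (resid C (beta 0%N) k i last).
Proof.
move=> H; have := @resid_below C beta k.+1 i H (cf_h C k.+1).
by rewrite residS eqxx.
Qed.

(** * Degrees of the denominators and quality of the convergents *)

Section Denominators.
Variable C : precf F n.
Hypothesis mC : mCF C.

Lemma mCF_t k : lt_len k.+1 C -> 0 < (cf_t C k.+1)%:Z.
Proof. by case: mC => c1 _ _ /(c1 k.+1 isT); lia. Qed.

Lemma mCF_lt k : lt_len k.+2 C ->
  iv_lt (cf_h C k.+1, (cv C k (cf_h C k.+1))%:E%E)
        (cf_h C k.+2, (cv C k.+2 (cf_h C k.+2))%:E%E).
Proof. by case: mC => _ c2 _ /(c2 k.+1 isT). Qed.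

(** Condition 3 coefficientwise; its leading exponent v_(k,h) - v_(k+1,h) is -t_(k+1). *)
Lemma mCF_a k : lt_len k.+1 C ->
  let h := cf_h C k.+1 in
  wge (cv C k.+1) (vpoly (cf_a C k.+1)) h (cv C k h) /\
  vpoly (cf_a C k.+1) h 0 (- (cf_t C k.+1)%:Z) != 0.
Proof.
case: mC => _ _ c3 /(c3 k.+1 isT)/Iv_finP[H c0]; split=> //.
have -> : - (cf_t C k.+1)%:Z = cv C k (cf_h C k.+1) - cv C k.+1 (cf_h C k.+1).
  by rewrite cvS; lia.
exact: c0.
Qed.

Local Notation Q k j := (lpoly (cf_B C k last (lshift 1 j))).
Local Notation q k := (lpoly (cf_B C k last last)).

(* The degree of q_k is t_1 + ... + t_k. The bound on the columns of B_k, which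
   are earlier convergents, is lexicographic: by Condition 2 it passes from
   h_k to h_(k+1), and by Condition 3 it makes a_(k, h_k) q_(k-1) the only term
   of maximal degree in q_k. *)
Lemma denominator_deg k : lt_len k C ->
  [/\ vanishes_below (- (cf_s C k)%:Z) (q k), q k (- (cf_s C k)%:Z) != 0 &
   lt_len k.+1 C -> forall j, let h := cf_h C k.+1 in
    vanishes_below (cv C k j - (cf_s C k)%:Z - cv C k.+1 h + (h <= j)%N%:Z) (Q k j)].
Proof.
elim: k => [_|k IHk lk].
  rewrite cf_B0 eqxx rmorph1 cf_s0 oppr0; split=> [t t0||_ j].
  - by rewrite lcoef1 lt_eqF.
  - by rewrite lcoef1 oner_eq0.
  - by rewrite cf_B0 eq_rlshift raddf0.
have [qv q0 Qv] := IHk (lt_lenW (leqnSn _) lk); have {Qv} := Qv lk.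
set h := cf_h C k.+1; set s := (cf_s C k)%:Z => /= Qv.
have tp := mCF_t lk; have [aw a0] := mCF_a lk; rewrite -/h in aw a0.
have vE : cv C k.+1 h = cv C k h + (cf_t C k.+1)%:Z := cvS C k.
have sE : (cf_s C k.+1)%:Z = s + (cf_t C k.+1)%:Z by rewrite cf_sS PoszD.
(* At j = h the new column is the last one of B_k, whose degree s is attained; so the summand 1 is
   lost there. *)
have QS j : vanishes_below (cv C k.+1 j - s - cv C k.+1 h + (h < j)%N%:Z) (Q k.+1 j).
  rewrite cf_BS; case: eqVneq => [->|jh].
    by rewrite -/h; apply: vanishes_belowW qv; rewrite ltnn; lia.
  rewrite cvS_neq//; apply: vanishes_belowW (Qv j); lia.
have rest : vanishes_below (- s - (cf_t C k.+1)%:Z + 1)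
    (q k.+1 - q k * vpoly (cf_a C k.+1) h 0).
  rewrite cf_BS_last rmorphD rmorph_sum /= -/h (bigD1 h)//= cf_BS eqxx.
  rewrite rmorphM /= -vpoly_eq addrCA [_ * _ + (_ + _)]addrC addrK.
  apply: vanishes_belowD; first by apply: vanishes_belowW (Qv h); rewrite leqnn; lia.
  apply: vanishes_below_sum => j jh; rewrite rmorphM /= -vpoly_eq.
  apply: vanishes_belowW (vanishes_belowM (QS j) (aw j)).
  (* The strictness comes from the bound on a for j < h and from the bound on the column for j >
     h. *)
  by move: jh; rewrite -val_eqE /=; case: (ltngtP j h) => //; lia.
have av : vanishes_below (- (cf_t C k.+1)%:Z) (vpoly (cf_a C k.+1) h 0).
  by apply: vanishes_belowW (aw h); rewrite ltnn; lia.
have qE : q k.+1 = q k.+1 - q k * vpoly (cf_a C k.+1) h 0 +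
                   q k * vpoly (cf_a C k.+1) h 0 by rewrite subrK.
have sE' : - (cf_s C k.+1)%:Z = - s + - (cf_t C k.+1)%:Z by lia.
split=> [||lk2 j].
- rewrite qE sE'; apply: vanishes_belowD; last exact: vanishes_belowM.
  by apply: vanishes_belowW rest; lia.
- rewrite qE sE' lcoefD lcoefM_low// rest ?add0r ?mulf_neq0//; lia.
(* Condition 2 turns the tie-break [h < j] into [h' <= j]: if the exponents agree, then h < h'. *)
- set h' := cf_h C k.+2; apply: vanishes_belowW (QS j).
  have := mCF_lt lk2; rewrite -/h -/h' iv_lt_fin => /orP[|/andP[/eqP]].
    by case: leqP; case: leqP; lia.
  by case: leqP; case: leqP; lia.
Qed.

(** The error is -R / q_k, where R has order at least v_(k+1) and 1 / q_k has order t_1 + ... + t_k,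
    which is at least k because every t_i is positive. *)
Lemma approx beta k : lt_len k C -> (forall l, (l <= k)%N -> tail_at C beta l) ->
  forall i, vanishes_below k%:Z ((beta 0%N - convergent C k) i 0).
Proof.
move=> lk H i; have [qv q0 _] := denominator_deg lk.
have := resid_last_below i H.
have [iv _] := laurent_inv_low qv q0.
have q0' := laurent_neq0 q0.
have -> : (beta 0%N - convergent C k) i 0 =
   - (resid C (beta 0%N) k i last * (q k)^-1).
  rewrite /resid mulrBl mulrAC divff// mul1r opprB /convergent !mxE; congr (_ - _).
  by rewrite mulrC /cf_q /cf_p !mxE.
move=> rv; apply/vanishes_belowN; apply: vanishes_belowW (vanishes_belowM rv iv).
have : k%:Z <= (cf_s C k)%:Z; last by have := cv_ge0 C k.+1 (cf_h C k.+1); lia.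
elim: k lk {H qv q0 iv q0' rv} => // k IHk lk; rewrite cf_sS.
by have := mCF_t lk; have := IHk (lt_lenW (leqnSn _) lk); lia.
Qed.

(** With beta_k = 0, the relation [resid_sum] reduces to p_k - q_k beta_0 = 0. *)
Lemma convergent_tail0 beta k : lt_len k C -> (forall l, (l < k)%N -> tail_at C beta l) ->
  beta k = 0 -> convergent C k = beta 0%N.
Proof.
move=> lk H bk; apply/colP => i; have := resid_sum i H.
have [_ /laurent_neq0 q0 _] := denominator_deg lk.
rewrite bk big1 ?add0r => [|j _]; last by rewrite mxE mulr0.
rewrite /resid => /eqP; rewrite subr_eq0 => /eqP E.
by rewrite !mxE; apply: (mulfI q0); rewrite -E mulrA /cf_q !mxE divff// mul1r.
Qed.

End Denominators.

End Approximation.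

(** * Tails and limits *)

Section Tails.
Local Open Scope ring_scope.
Variables (F : fieldType) (n : nat).
Local Notation m := n.+1.
Local Notation Lvec := 'cV[laurent F]_m.
Local Notation Pvec := 'cV[{poly F}]_m.
Implicit Types (C : precf F n) (r x y : Lvec) (h j : 'I_m) (k : nat) (beta : nat -> Lvec).

(* The k-th tail (beta_k in the transform) of the truncation of C at k + d. *)
Fixpoint btail C (d k : nat) : Lvec :=
  if d is d'.+1 then
    rho (cf_h C k.+1) (vpoly (cf_a C k.+1) + btail C d' k.+1)
  else 0.

(** As b lies strictly beyond the leading monomial of a, Condition 3 gives the leading monomial of a
    + b, and [rho_wge] carries it over to y. *)
Lemma btail_step C k b : mCF C -> lt_len k.+1 C ->
  let h := cf_h C k.+1 in let y := rho h (vpoly (cf_a C k.+1) + b) in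
  wgt (cv C k.+1) b h (cv C k h) ->
  [/\ wge (cv C k) y h (cv C k.+1 h), y h 0 (cf_t C k.+1)%:Z != 0 &
      vpoly (cf_a C k.+1) + b = rho h y].
Proof.
move=> mC lk h y bw; have [aw a0] := mCF_a mC lk; rewrite -/h in aw a0.
have vE : cv C k.+1 h = cv C k h + (cf_t C k.+1)%:Z := cvS C k.
have vj j : j != h -> cv C k j = cv C k.+1 j by move=> /cvS_neq.
have vE' : cv C k h = cv C k.+1 h + - (cf_t C k.+1)%:Z by lia.
set x := _ + b in y *.
have xw : wge (cv C k.+1) x h (cv C k h) by apply: wgeD (wgtW bw).
have x0 : x h 0 (- (cf_t C k.+1)%:Z) != 0.
  by rewrite mxE lcoefD bw ?addr0//; lia.
have [yw y0] := rho_wge vE' vj xw x0; rewrite opprK in y0.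
by split=> //; rewrite rhoK// (laurent_neq0 x0).
Qed.

(** Induction from the end of the truncation: Condition 2 puts the leading monomial of the next tail
    strictly beyond that of a_(k+1). *)
Lemma btailP C d k : mCF C -> lt_len (d.+1 + k) C ->
  let h := cf_h C k.+1 in
  [/\ wge (cv C k) (btail C d.+1 k) h (cv C k.+1 h),
      btail C d.+1 k h 0 (cf_t C k.+1)%:Z != 0 &
      vpoly (cf_a C k.+1) + btail C d k.+1 = rho h (btail C d.+1 k)].
Proof.
move=> mC; elim: d k => [|d IHd] k lk h.
  by apply: btail_step => //; apply: wgt0.
have lk2 : lt_len k.+2 C by apply: lt_lenW lk; lia.
have lkd : lt_len (d.+1 + k.+1) C by rewrite addnS.
have [bw _ _] := IHd k.+1 lkd; apply: btail_step => //.
  exact: lt_lenW lk2.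
exact: wge_lt bw (mCF_lt mC lk2).
Qed.

Lemma tail_at_btail C N k : mCF C -> lt_len N C -> (k < N)%N ->
  tail_at C (fun l => btail C (N - l) l) k.
Proof.
move=> mC lN kN; rewrite /tail_at (_ : N - k = (N - k.+1).+1)%N; last lia.
by apply: btailP => //; rewrite addSnnS subnK.
Qed.

Lemma convergent_btail C N : mCF C -> lt_len N C -> convergent C N = btail C N 0.
Proof.
move=> mC lN.
rewrite (@convergent_tail0 _ _ _ mC (fun l => btail C (N - l) l) N) ?subn0 ?subnn//.
by move=> l; apply: tail_at_btail.
Qed.

(** The N-th convergent is the value of the truncation at N, to whose tails [approx] applies for
    every k < N. *)
Lemma convergent_cauchy C N k : mCF C -> lt_len N C -> (k <= N)%N ->
  forall i, vanishes_below k%:Z ((convergent C N - convergent C k) i 0).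
Proof.
move=> mC lN; rewrite leq_eqVlt => /orP[/eqP->|kN] i.
  by rewrite subrr mxE.
rewrite convergent_btail//.
have := @approx _ _ _ mC (fun l => btail C (N - l) l) k (lt_lenW (ltnW kN) lN).
rewrite subn0; apply => l lk.
by apply: tail_at_btail => //; apply: leq_ltn_trans kN.
Qed.

Lemma convergent0 C : mCF C -> convergent C 0 = 0.
Proof. by move=> mC; rewrite convergent_btail//; case: C mC. Qed.

Lemma vcvg_unique (u : nat -> Lvec) r s : vcvg u r -> vcvg u s -> r = s.
Proof.
move=> ur us; apply/colP => i; apply/eqP; rewrite -subr_eq0; apply/eqP.
apply: vanishes_below_all => N.
have [K uK] := ur N; have [L uL] := us N.
have /vval_ge/(_ i) := uK _ (leq_maxl K L); have /vval_ge/(_ i) := uL _ (leq_maxr K L).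
rewrite !mxE => /vanishes_belowN h1 h2; have := vanishes_belowD h2 h1.
by rewrite opprB addrA subrK.
Qed.

Lemma phi_inf (f : nat -> 'I_m * Pvec) : mCF (CFinf f) -> forall k i,
  vanishes_below k%:Z ((phi (CFinf f) - convergent (CFinf f) k) i 0).
Proof.
move=> mC; set C := CFinf f.
have c0 k i : vanishes_below 0 (convergent C k i 0).
  by have := convergent_cauchy mC (isT : lt_len k C) (leq0n k) i; rewrite convergent0 ?subr0.
(* The coefficient at t is taken from the convergent of index |t| + 1, from which on it no longer
   changes. *)
pose f' i t := convergent C (absz t).+1 i 0 t.
have fb i : exists N, vanishes_below N (f' i) by exists 0 => t t0; apply: c0.
pose r : Lvec := \col_i Laurent (fb i).
have rP k i : vanishes_below k%:Z ((r - convergent C k) i 0).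
  have E (u w : Lvec) : (u - w) i 0 = u i 0 - w i 0 by rewrite !mxE.
  move=> t tk; rewrite E lcoefB.
  have -> : lcoef (r i 0) t = convergent C (absz t).+1 i 0 t by rewrite [r i 0]mxE.
  have [t0|t0] := ltP t 0; first by rewrite !(c0 _ _ _ t0) subrr.
  have tk' : ((absz t).+1 <= k)%N by lia.
  have /vanishes_belowN/(_ t) := convergent_cauchy mC (isT : lt_len k C) tk' i.
  by rewrite E opprB lcoefB; apply; lia.
suff -> : phi C = r by [].
have rc : vcvg (convergent C) r.
  move=> N; exists (absz N) => k Nk; apply/vval_ge => i.
  by apply: vanishes_belowW (rP k i); lia.
rewrite /phi; apply: xget_unique => // s sc; exact: vcvg_unique sc rc.
Qed.

(** * Continuity of the inversion and tails of infinite fractions *)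

Lemma wge_close c x y h v t M : wge c y h v -> y h 0 t != 0 ->
  (forall j, v + 1 - c j <= M) -> t < M ->
  (forall j, vanishes_below M ((x - y) j 0)) ->
  wge c x h v /\ x h 0 t != 0.
Proof.
move=> yw yt cM tM xy.
have xE j : x j 0 = (x - y) j 0 + y j 0 by rewrite !mxE subrK.
split=> [j|]; last by rewrite xE lcoefD xy// add0r.
rewrite xE; apply: vanishes_belowD => //.
by apply: vanishes_belowW (xy j); have := cM j; case: ltnP => _; lia.
Qed.

(** The identity 1/x_h - 1/y_h = -(x_h - y_h)/(x_h y_h) costs 2t digits of precision; the factor y_j
    in the other entries costs -L more. *)
Lemma rho_close x y h t L M : 0 <= t -> L <= 0 ->
  vanishes_below t (x h 0) -> x h 0 t != 0 ->
  vanishes_below t (y h 0) -> y h 0 t != 0 ->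
  (forall j, vanishes_below L (y j 0)) ->
  (forall j, vanishes_below M ((x - y) j 0)) ->
  forall j, vanishes_below (M - t - t + L) ((rho h x - rho h y) j 0).
Proof.
move=> t0 L0 xv xt yv yt yL xy j.
have [ixv _] := laurent_inv_low xv xt; have [iyv _] := laurent_inv_low yv yt.
have xn := laurent_neq0 xt; have yn := laurent_neq0 yt.
have iE : (x h 0)^-1 - (y h 0)^-1 = - ((x - y) h 0 * (x h 0)^-1 * (y h 0)^-1).
  rewrite !mxE mulrBl divff// mulrBl mul1r opprB mulrAC divff// mul1r.
  by [].
have iv : vanishes_below (M - t - t) (((x h 0)^-1 - (y h 0)^-1)%R).
  rewrite iE; apply: vanishes_belowN; apply: vanishes_belowM iyv.
  exact: vanishes_belowM.
rewrite !mxE; case: ifP => _; first by apply: vanishes_belowW iv; lia.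
have -> : x j 0 / x h 0 - y j 0 / y h 0 =
   (x - y) j 0 / x h 0 + y j 0 * ((x h 0)^-1 - (y h 0)^-1).
  by rewrite !mxE mulrBl mulrBr addrA subrK.
apply: vanishes_belowD.
  by apply: vanishes_belowW (vanishes_belowM (xy j) ixv); lia.
by apply: vanishes_belowW (vanishes_belowM (yL j) iv); lia.
Qed.

(** Remainders computed forwards from r with the digits of C, whereas [btail] starts from the end of
    a truncation. *)
Fixpoint ftail C r k : Lvec :=
  if k is k'.+1 then rho (cf_h C k) (ftail C r k') - vpoly (cf_a C k) else r.

(** Induction on k: closeness of the k-th tails makes their leading terms agree, and then
    [rho_close] yields closeness of the next ones. *)
Lemma ftail_close (f : nat -> 'I_m * Pvec) k : let C := CFinf f in mCF C -> forall M : int,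
  exists K, forall N, (K <= N)%N ->
    forall i, vanishes_below M ((ftail C (phi C) k - btail C (N - k) k) i 0).
Proof.
move=> C mC; elim: k => [|k IHk] M.
  exists (absz M) => N MN i; rewrite subn0 -convergent_btail//.
  by apply: vanishes_belowW (@phi_inf _ mC N i); lia.
set h := cf_h C k.+1; set v := cv C k.+1 h; set t := (cf_t C k.+1)%:Z.
set s := (cf_s C k)%:Z.
have v0 : 0 <= v by []. have t0 : 0 <= t by []. have s0 : 0 <= s by [].
(* [rho_close] loses 2t + s digits; the other summands let [wge_close] fix the leading terms. *)
pose M' := `|M| + v + t + t + s + 2.
have [K HK] := IHk M'; exists (K + k.+1)%N => N KN i.
have {}HK := HK N (leq_trans (leq_addr _ _) KN).
have [yw y0 yE] : tail_at C (fun l => btail C (N - l) l) k.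
  by apply: tail_at_btail => //; lia.
rewrite -/h -/v -/t in yw y0 yE.
have cs j : 0 <= cv C k j <= s by rewrite cv_ge0 cv_le_s.
have vE : v = cv C k h + t := cvS C k.
have cM j : v + 1 - cv C k j <= M' by have := cs j; rewrite /M'; lia.
have tM : t < M' by rewrite /M'; lia.
have [xw x0] := wge_close yw y0 cM tM HK.
rewrite (_ : _ - _ = rho h (ftail C (phi C) k) - rho h (btail C (N - k) k)); last first.
  by rewrite -yE /= -/h opprD addrA.
have L0 : - s <= 0 by lia.
have xt : vanishes_below t (ftail C (phi C) k h 0).
  by apply: vanishes_belowW (xw h); lia.
have yt : vanishes_below t (btail C (N - k) k h 0).
  by apply: vanishes_belowW (yw h); lia.
have yL j : vanishes_below (- s) (btail C (N - k) k j 0).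
  by apply: vanishes_belowW (yw j); have := cs j; lia.
by apply: vanishes_belowW (rho_close t0 L0 xt x0 yt y0 yL HK i); rewrite /M'; lia.
Qed.

(** A finite C has its own backward tails. For an infinite C the forward tails of its value serve,
    each being so close to a tail of a long truncation that their leading terms agree. *)
Lemma tails_exist C : mCF C -> exists beta,
  [/\ beta 0%N = phi C, forall k, lt_len k.+1 C -> tail_at C beta k &
      forall k, lt_len k C -> ~~ lt_len k.+1 C -> beta k = 0].
Proof.
case: C => [s|f] mC.
  exists (fun k => btail (CFfin s) (size s - k) k); split.
  - by rewrite subn0 /= convergent_btail /=.
  - by move=> k ks; apply: tail_at_btail => //=.
  - by move=> k /= ks sk; rewrite (_ : _ - _ = 0)%N//; lia.
exists (ftail (CFinf f) (phi (CFinf f))); split=> // k _.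
set C := CFinf f; set h := cf_h C k.+1.
have [K HK] := @ftail_close f k mC (cv C k.+1 h + (cf_t C k.+1)%:Z + 2).
have {}HK := HK (K + k.+1)%N (leq_addr _ _).
have [yw y0 yE] : tail_at C (fun l => btail C ((K + k.+1) - l) l) k.
  by apply: tail_at_btail => //; lia.
set M := _ + 2 in HK.
have cM j : cv C k.+1 h + 1 - cv C k j <= M.
  by have := cv_ge0 C k j; rewrite /M; lia.
have tM : (cf_t C k.+1)%:Z < M by have := cv_ge0 C k.+1 h; rewrite /M; lia.
have [xw x0] := wge_close yw y0 cM tM HK.
by split=> //=; rewrite addrC subrK.
Qed.

End Tails.

(** * The transform *)

Section Transform.
Local Open Scope ring_scope.
Variables (F : fieldType) (n : nat).
Local Notation m := n.+1.
Local Notation Lvec := 'cV[laurent F]_m.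
Local Notation Pvec := 'cV[{poly F}]_m.
Implicit Types (C : precf F n) (r b : Lvec) (h j : 'I_m) (k : nat) (beta : nat -> Lvec).
Implicit Types (s : state F n) (a e : Pvec) (eps : strategy F n) (c : 'I_m -> int).

Lemma vfloorD a b : vfloor (vpoly a + b) = a + vfloor b.
Proof.
apply/colP => j; rewrite !mxE -[b j 0 in LHS]lfracK addrA -rmorphD.
by apply: lfloorE; apply: lfrac_gt0.
Qed.

Lemma vfracD a b : vfrac (vpoly a + b) = vfrac b.
Proof.
have := vfracK (vpoly a + b); rewrite vfloorD -{3}(vfracK b).
have -> : vpoly (a + vfloor b) = vpoly a + vpoly (vfloor b).
  by apply/colP => j; rewrite !mxE rmorphD.
by rewrite -!addrA => /addrI E; apply: addrI E.
Qed.

Lemma vfloor0 : vfloor (0 : Lvec) = 0.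
Proof. by apply/colP => j; rewrite !mxE; apply/polyP => i; rewrite coef_lfloor coef0. Qed.

Lemma vfrac0 : vfrac (0 : Lvec) = 0.
Proof. by have := vfracK (0 : Lvec); rewrite vfloor0 vpoly0 add0r. Qed.

Lemma wge_vfrac c b h v : wge c b h v -> wge c (vfrac b) h v.
Proof. by move=> H j; rewrite mxE; apply: vanishes_below_lfrac. Qed.

Lemma wge_vfloor c b h v : wge c b h v -> wge c (vpoly (vfloor b)) h v.
Proof.
move=> H j; have -> : vpoly (vfloor b) j 0 = b j 0 - lfrac (b j 0).
  by rewrite !mxE -{2}(lfracK (b j 0)) addrK.
by apply: vanishes_belowB => //; apply: vanishes_below_lfrac.
Qed.

Lemma vfrac_gt0 b j : vanishes_below 1 (vfrac b j 0).
Proof. by rewrite mxE; apply: lfrac_gt0. Qed.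

(** The leading term sits in b at the positive order [v - c h], so it survives in the fractional
    part. *)
Lemma Iv_vfrac c b h v : Iv (Diagz F c *m b) = (h, v%:E%E) -> c h < v ->
  Iv (Diagz F c *m vfrac b) = (h, v%:E%E).
Proof.
move=> /Iv_finP[H b0] cv; apply: IvP; first exact: wge_vfrac.
by rewrite mxE lfracE ifF//; lia.
Qed.

(* A term of e and a term of the fractional part never cancel. *)
Lemma admissible_Iv c e r :
  iv_le (Iv (Diagz F c *m vfrac r)) (Iv (Diagz F c *m vpoly e)) ->
  Iv (Diagz F c *m (vfrac r + vpoly e)) = Iv (Diagz F c *m vfrac r).
Proof.
case: (Iv_cases c (vfrac r)) => [[-> ->]|[h [v [H r0 ->]]]].
  (* A zero fractional part has infinite [Iv], so admissibility forces e = 0. *)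
  case: (Iv_cases c (vpoly e)) => [[-> _] _|[j [w [_ _ ->]]]].
    by rewrite addr0 mulmx0 Iv0.
  by rewrite /iv_le iv_lt_ltop xpair_eqE andbF.
move=> /iv_le_wge H'; apply: IvP; first exact: wgeD.
have v0 : 0 < v - c h.
  rewrite ltNge; apply: contra_neqN r0 => v0; rewrite vfrac_gt0//; lia.
by rewrite mxE lcoefD vpoly_eq lpoly_gt0// addr0.
Qed.

(** Invariant of the transform: the leading term has positive order in beta itself. It makes the
    degree t of the next digit positive. *)
Definition positive_state s := forall h v,
  Iv (Diagz F (st_c s) *m st_beta s) = (h, v%:E%E) -> st_c s h < v.

Lemma step_hE s h v : Iv (Diagz F (st_c s) *m st_beta s) = (h, v%:E%E) ->
  [/\ step_h s = h, step_c s h = v & forall j, j != h -> step_c s j = st_c s j].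
Proof.
rewrite /Iv /step_c /step_h -/(step_vec s) => -[-> ->]; split=> // [|j /negbTE-> //].
by rewrite eqxx.
Qed.

Lemma step_rhoE s : step_rho s = rho (step_h s) (st_beta s).
Proof. by []. Qed.

Lemma step_beta s e :
  vpoly (step_digit s e).2 + st_beta (step s e) = step_rho s.
Proof.
rewrite /= vpolyB -[RHS]vfracK -addrA; congr (_ + _).
by rewrite addrC addrK.
Qed.

(** By [rho_wge], rho has the leading monomial (h, c_h) with the old c_h. The fractional part and,
    by admissibility, epsilon lie strictly beyond it, so the digit inherits it. *)
Lemma stepP s e (h := step_h s) :
  positive_state s -> st_beta s != 0 -> admissible s e ->
  [/\ 0 < step_c s h - st_c s h,
      Iv (Diagz F (st_c s) *m st_beta s) = (h, (step_c s h)%:E%E),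
      Iv (Diagz F (step_c s) *m vpoly (step_digit s e).2) = (h, (st_c s h)%:E%E),
      wgt (step_c s) (st_beta (step s e)) h (st_c s h) &
      positive_state (step s e)].
Proof.
move=> sP b0 adm.
case: (Iv_cases (st_c s) (st_beta s)) => [[/eqP]|[h' [v [bw bn Ivb]]]].
  by rewrite (negbTE b0).
have [hE ch cj] := step_hE Ivb; have vc := sP _ _ Ivb.
rewrite -hE -/h in bw bn Ivb ch cj vc *; rewrite {h' hE}.
have vE : step_c s h = st_c s h + (v - st_c s h) by lia.
rewrite -ch in bw Ivb; have [rw r0] := rho_wge vE cj bw bn.
rewrite -step_rhoE in rw r0.
(* At h the positive order gives strictness; at any other j the conditions [j < h] and [j <= h]
   agree. *)
have fw : wgt (step_c s) (vfrac (step_rho s)) h (st_c s h).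
  move=> j; have [->|jh] := eqVneq j h.
    by apply: vanishes_belowW (vfrac_gt0 (step_rho s) h); lia.
  by apply: vanishes_belowW (wge_vfrac rw (j := j)); move: jh; rewrite -val_eqE /=; lia.
have ew : wgt (step_c s) (vpoly e) h (st_c s h).
  by apply: iv_lt_wgt; apply: iv_lt_le_trans adm; apply: wgt_iv_lt.
have bw' : wgt (step_c s) (st_beta (step s e)) h (st_c s h) by apply: wgtD.
split=> //; first lia.
  have aE := step_beta s e; set a := vpoly _ in aE *.
  have {aE} -> : a = step_rho s - st_beta (step s e) by rewrite -aE addrK.
  apply: IvP; first by apply: wgeD => //; apply: wgtW; apply: wgtN.
  have BE (u w : Lvec) : (u - w) h 0 = u h 0 - w h 0 by rewrite !mxE.
  rewrite BE lcoefB [X in _ - X]bw' ?subr0; last lia.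
  by rewrite (_ : _ - _ = - (v - st_c s h))//; lia.
(* The next leading term is one of the fractional part, hence of positive order. *)
move=> h' w /=; rewrite admissible_Iv// => /Iv_finP[_].
by rewrite ltNge; apply: contra_neqN => wc; rewrite vfrac_gt0//; lia.
Qed.

Lemma output_cases r eps : let C := output r eps in
  (forall k, lt_len k.+1 C -> (forall i, (i <= k)%N -> st_beta (run r eps i) != 0) /\
     digit C k.+1 = output_digit r eps k) /\
  (forall k, lt_len k C -> ~~ lt_len k.+1 C -> st_beta (run r eps k) = 0).
Proof.
rewrite /output; case: pselect => [stops|nstops].
  case: ex_minnP => N /eqP bN Nmin; split=> k /=; rewrite size_mkseq !ltnS.
    move=> kN; split; last by rewrite nth_mkseq.
    by move=> i ik; apply: contraTN kN => /Nmin Ni; rewrite -leqNgt; lia.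
  by move=> kN; rewrite -leqNgt => Nk; rewrite (_ : k = N)//; apply/eqP; rewrite eqn_leq kN.
by split=> // k _; split=> // i _; apply/negP => bi; apply: nstops; exists i.
Qed.

Lemma output_eq C r eps :
  (forall k, lt_len k.+1 C -> st_beta (run r eps k) != 0 /\
     digit C k.+1 = output_digit r eps k) ->
  (forall k, lt_len k C -> ~~ lt_len k.+1 C -> st_beta (run r eps k) = 0) ->
  output r eps = C.
Proof.
rewrite /output; case: C => [s|f] H1 H2; case: pselect => [stops|nstops].
- case: ex_minnP => N bN Nmin; have NE : N = size s.
    apply/eqP; rewrite eqn_leq Nmin ?H2 /= ?ltnn//= leqNgt.
    by apply: contraL bN => Ns; have [] := H1 N Ns.
  congr CFfin; apply: (@eq_from_nth _ (ord0, 0)); rewrite size_mkseq//.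
  by move=> i iN; rewrite nth_mkseq//; have [|_ <-] := H1 i; rewrite //= ltnS -NE.
- by case: nstops; exists (size s); rewrite H2 /= ?ltnn.
- by case: (stops) => k bk; have [] := H1 k isT; rewrite bk.
- by congr CFinf; apply: funext => k; have [] := H1 k isT.
Qed.

(** For finite C the last tail is 0 and [convergent_tail0] applies; otherwise [approx] makes the
    convergents tend to beta_0. *)
Lemma phi_tails C beta : mCF C ->
  (forall k, lt_len k.+1 C -> tail_at C beta k) ->
  (forall k, lt_len k C -> ~~ lt_len k.+1 C -> beta k = 0) -> phi C = beta 0%N.
Proof.
case: C => [l|f] mC bt bs.
  by apply: convergent_tail0 => //=; apply: bs; rewrite /= ?ltnn.
have bv : vcvg (convergent (CFinf f)) (beta 0%N).
  move=> N; exists (absz N) => k Nk; apply/vval_ge => i.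
  have := @approx _ _ _ mC beta k isT (fun l _ => bt l isT) i.
  by apply: vanishes_belowW; lia.
by rewrite /phi; apply: xget_unique => // s sv; exact: vcvg_unique sv bv.
Qed.

(** * Outputs of the transform are m-continued fractions with value r *)

Section Output.
Variables (r : Lvec) (eps : strategy F n).
Hypotheses (rS : Sset F n r) (adm : admissible_for r eps).
Let C := output r eps.
Let st k := run r eps k.

(** Inductive step for the equality of the exponents c_k and v_(k,j): the exponent gained at h is
    the degree of the h-th entry of the digit. *)
Lemma output_step k : lt_len k.+1 C -> st_c (st k) = cv C k ->
  positive_state (st k) ->
  let h := cf_h C k.+1 in
  [/\ st_c (st k.+1) = cv C k.+1, positive_state (st k.+1),
      [/\ tail_at C (fun i => st_beta (st i)) k, 
      Iv (Diagz F (cv C k) *m st_beta (st k)) = (h, (cv C k.+1 h)%:E%E),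
      (0 < cf_t C k.+1)%N &
      Iv (Diagz F (cv C k.+1) *m vpoly (cf_a C k.+1)) = (h, (cv C k h)%:E%E)] &
      wgt (cv C k.+1) (st_beta (st k.+1)) h (cv C k h)].
Proof.
move=> lk cE sP h.
have [/(_ k lk)[bn dE] _] := output_cases r eps; rewrite -/C -/(st _) in dE.
set s := st k in cE sP bn dE; set e := eps k s.
have hE : step_h s = h by rewrite /h /cf_h dE.
have aE : (step_digit s e).2 = cf_a C k.+1 by rewrite /cf_a dE.
have [t0 Ivb Iva bw' s'P] := stepP sP (bn k (leqnn k)) (adm bn).
have ce : step_c s h - st_c s h = (cf_t C k.+1)%:Z.
  have [aw an] := Iv_finP Iva; rewrite hE -/(st k) -/s in t0 aw an.
  rewrite /cf_t -/h -aE.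
  set t := _ - _ in t0 *; have tE : t = (absz t)%:Z by lia.
  have -> : size ((step_digit s e).2 h 0) = (absz t).+1; last by [].
  apply: size_lpoly; rewrite -vpoly_eq -tE.
    by apply: vanishes_belowW (aw h); lia.
  by move: an; congr (vpoly _ _ _ _ != 0); lia.
have cS : step_c s = cv C k.+1.
  apply: funext => j; have [->|jh] := eqVneq j h.
    by rewrite cvS -/h -cE; lia.
  by rewrite cvS_neq// -cE /step_c hE (negbTE jh).
have cSE : st_c (st k.+1) = cv C k.+1 by [].
have IvbE : Iv (Diagz F (cv C k) *m st_beta (st k)) = (h, (cv C k.+1 h)%:E%E).
  by rewrite -cE -cS -hE.
split=> //.
- split=> //.
  + have [bw b0] := Iv_finP IvbE; split=> //; rewrite -/h.
      by move: b0; congr (st_beta _ _ _ _ != 0); rewrite -cS -cE.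
    by rewrite -aE -/s -hE -step_rhoE; exact: step_beta.
  + by rewrite hE in t0; lia.
  + by rewrite -aE -cS -cE -hE.
- by rewrite -cE -cS -hE.
Qed.

Lemma output_run k : lt_len k C -> st_c (st k) = cv C k /\ positive_state (st k).
Proof.
elim: k => [_|k IHk lk].
  split; first by apply: funext => j; rewrite cv0.
  move=> h v /Iv_finP[_ /=]; rewrite subr0 ltNge => rh; apply: contra_neqN rh => v0.
  have : (1%:E <= vval r)%E.
    by move: rS; rewrite /Sset /=; case: (vval r) => // x; rewrite lte_fin lee_fin.
  by move=> /vval_ge/(_ h); apply; lia.
have [cE sP] := IHk (lt_lenW (leqnSn _) lk).
by have [] := output_step lk cE sP.
Qed.

Lemma output_Iv k (h := cf_h C k.+1) : lt_len k.+1 C ->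
  Iv (Diagz F (cv C k) *m st_beta (st k)) = (h, (cv C k.+1 h)%:E%E).
Proof.
move=> lk; have [cE sP] := output_run (lt_lenW (leqnSn _) lk).
by have [_ _ [_ ? _ _]] := output_step lk cE sP.
Qed.

Lemma output_tail k : lt_len k.+1 C -> tail_at C (fun i => st_beta (st i)) k.
Proof.
move=> lk; have [cE sP] := output_run (lt_lenW (leqnSn _) lk).
by have [_ _ [? _ _ _]] := output_step lk cE sP.
Qed.

Lemma output_mCF : mCF C.
Proof.
split=> -[//|k] _ lk.
- have [cE sP] := output_run (lt_lenW (leqnSn _) lk).
  by have [_ _ [_ _ ? _]] := output_step lk cE sP.
- have lk1 := lt_lenW (leqnSn _) lk.
  have [cE sP] := output_run (lt_lenW (leqnSn _) lk1).
  have [_ _ _ bw] := output_step lk1 cE sP.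
  (* By [output_Iv] the right-hand side of Condition 2 is [Iv] of the weighted remainder, which lies
     strictly beyond the left-hand side. *)
  by rewrite /iv_before /iv_after -/(cv _ _ _) -output_Iv//; apply: wgt_iv_lt.
- have [cE sP] := output_run (lt_lenW (leqnSn _) lk).
  by have [_ _ [_ _ _ ?]] := output_step lk cE sP.
Qed.

Lemma phi_output : phi C = r.
Proof.
apply: (phi_tails output_mCF (beta := fun k => st_beta (st k))) => k; first exact: output_tail.
by have [_] := output_cases r eps; apply.
Qed.

End Output.

(** * Recovering an m-continued fraction as an output *)

Section Reproduce.
Variables (C : precf F n) (beta : nat -> Lvec) (eps : strategy F n).
Hypotheses (mC : mCF C) (b0 : beta 0%N = phi C)
  (btail : forall k, lt_len k.+1 C -> tail_at C beta k)
  (bstop : forall k, lt_len k C -> ~~ lt_len k.+1 C -> beta k = 0).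

Lemma tail_Iv k (h := cf_h C k.+1) : lt_len k.+1 C ->
  Iv (Diagz F (cv C k) *m beta k) = (h, (cv C k.+1 h)%:E%E).
Proof.
move=> /btail[bw bn _]; apply: IvP => //; rewrite -/h.
rewrite (_ : _ - _ = (cf_t C k.+1)%:Z)//.
by have := cvS C k; rewrite -/h; lia.
Qed.

Lemma tail_step k : lt_len k.+1 C -> let s := State (cv C k) (beta k) in
  [/\ step_h s = cf_h C k.+1, step_c s = cv C k.+1 &
      step_rho s = vpoly (cf_a C k.+1) + beta k.+1].
Proof.
move=> lk s; have [hE ch cj] := step_hE (s := s) (tail_Iv lk).
have [_ _ rE] := btail lk.
split=> //; last by rewrite rE step_rhoE hE.
apply: funext => j; have [->//|jh] := eqVneq j (cf_h C k.+1).
by rewrite cj// cvS_neq.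
Qed.

(** The only epsilon with which the step emits the digit of C. *)
Hypothesis epsE : forall k, lt_len k.+1 C -> let s := State (cv C k) (beta k) in
  eps k s = vfloor (step_rho s) - cf_a C k.+1.

Lemma run_tails k : lt_len k C -> run (phi C) eps k = State (cv C k) (beta k).
Proof.
elim: k => [_|k IHk lk].
  by rewrite b0 /=; congr State; apply: funext => j; rewrite cv0.
rewrite /= (IHk (lt_lenW (leqnSn _) lk)) epsE//; set s := State _ _.
have [hE cE rE] := tail_step lk; rewrite -/s in hE cE rE.
rewrite /step cE; congr State.
have := step_beta s (vfloor (step_rho s) - cf_a C k.+1).
by rewrite /step_digit /= (subKr (vfloor _)) rE => /addrI.
Qed.

Lemma output_tails : output (phi C) eps = C.
Proof.
apply: output_eq => k lk; last by move=> lk1; rewrite run_tails//; exact: bstop.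
have lk0 := lt_lenW (leqnSn _) lk; rewrite /output_digit run_tails//.
have [hE cE rE] := tail_step lk; split; last first.
  by rewrite epsE// /step_digit hE subKr /cf_h /cf_a; case: (digit C k.+1) => -[].
by have [_ /laurent_neq0 + _] := btail lk; apply: contra_neq => /= ->; rewrite mxE.
Qed.

(** Here epsilon is the polynomial part of beta_(k+1), while the leading monomial of beta_(k+1) lies
    in its fractional part. *)
Lemma tails_admissible : admissible_for (phi C) eps.
Proof.
move=> k bn.
(* C has not ended while the remainders are nonzero, since its last tail is 0. *)
have lk : lt_len k.+1 C.
  elim: k bn => [|k IHk] bn.
    have l0 : lt_len 0 C by case: (C).
    by apply/negPn/negP => /(bstop l0) bk; have := bn 0%N (leqnn _); rewrite run_tails// bk eqxx.
  have lk := IHk (fun i ik => bn i (leqW ik)).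
  by apply/negPn/negP => /(bstop lk) bk; have := bn _ (leqnn _); rewrite run_tails// bk eqxx.
rewrite run_tails ?(lt_lenW (leqnSn _) lk)// /admissible epsE//.
have [hE -> ->] := tail_step lk.
rewrite vfloorD vfracD addrAC subrr add0r.
have [lk2|/(bstop lk)->] := boolP (lt_len k.+2 C); last first.
  by rewrite vfrac0 vfloor0 vpoly0 iv_le_refl.
rewrite (Iv_vfrac (tail_Iv lk2)).
  by apply/wge_iv_le/wge_vfloor; have [] := btail lk2.
by rewrite cvS; have := mCF_t mC lk2; lia.
Qed.

End Reproduce.

Lemma Tset_CFset r : Sset F n r -> Tset r = CFset r.
Proof.
move=> rS; apply/seteqP; split=> C.
  by case=> eps adm <-; split; [exact: output_mCF|exact: phi_output].
case=> mC <-; have [beta [b0 bt bs]] := tails_exist mC.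
pose eps : strategy F n := fun k s => vfloor (step_rho s) - cf_a C k.+1.
exists eps; first exact: (tails_admissible mC b0 bt bs).
exact: (output_tails b0 bt bs).
Qed.

(** If C has a digit, every entry of beta_0 has order at least t_1, which is positive. *)
Lemma phi_Sset C : mCF C -> Sset F n (phi C).
Proof.
move=> mC; have [beta [<- bt bs]] := tails_exist mC.
have [lk|lk] := boolP (lt_len 1 C); last first.
  by rewrite bs ?/Sset /= ?vval0 ?ltey//; case: (C).
have [bw _ _] := bt 0%N lk.
apply: (@lt_le_trans _ _ 1%:E%E); first by rewrite lte_fin.
apply/vval_ge => j; apply: vanishes_belowW (bw j); rewrite cvS !cv0.
by have := mCF_t mC lk; lia.
Qed.

End Transform.

(** * The map psi *)

Section Psi.
Local Open Scope ring_scope.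
Variables (F : fieldType) (n : nat).
Local Notation m := n.+1.
Local Notation Lvec := 'cV[laurent F]_m.
Local Notation Pvec := 'cV[{poly F}]_m.
Implicit Types (C : precf F n) (r b u : Lvec) (h j : 'I_m) (k : nat) (x v : int).
Implicit Types (s : state F n) (a e : Pvec) (c : 'I_m -> int) (p : 'I_m * \bar int).

Lemma lcoef_monomial x j i t :
  @monomial F n x j i 0 t = ((i == j) && (t == - x))%:R.
Proof.
rewrite !mxE andbT; case: (i == j).
  rewrite mulr1 lz_expz -[LHS]/(if t == - x then 1 else 0); by case: ifP.
by rewrite mulr0.
Qed.

Lemma Iv_Diagz_monomial c x j :
  Iv (Diagz F c *m monomial F x j) = (j, (c j - x)%:E%E).
Proof.
apply: IvP => [i t|]; rewrite lcoef_monomial; last first.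
  have -> : c j - x - c j = - x by lia.
  by rewrite !eqxx oner_eq0.
by case: eqVneq => [->|//]; rewrite ltnn => tx; rewrite (_ : (t == - x) = false)//; lia.
Qed.

Lemma Iv_monomial x j : Iv (monomial F x j) = (j, (- x)%:E%E).
Proof.
have <- : Diagz F (fun=> 0) *m monomial F x j = monomial F x j.
  by apply/colP => i; apply: laurentP => t; rewrite lcoef_Diagz subr0.
by rewrite Iv_Diagz_monomial sub0r.
Qed.

Lemma monomials_of_Diagz_vpoly c a u : monomials_of (Diagz F c *m vpoly a) u <->
  exists j i, (a j 0)`_i != 0 /\ u = monomial F (i%:Z - c j) j.
Proof.
split=> [[[x j] /= xj <-]|[j [i [ai ->]]]].
  move: xj; rewrite lcoef_Diagz vpoly_eq lpolyE; case: ifP; rewrite ?eqxx// => t0 ax.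
  by exists j, (absz (- x - c j)); split=> //; congr monomial; lia.
exists (i%:Z - c j, j) => //=; rewrite lcoef_Diagz vpoly_eq lpolyE ifT; last lia.
by move: ai; congr (_`_ _ != 0); lia.
Qed.

Lemma iv_max_exists (l : seq ('I_m * \bar int)) : l != [::] ->
  exists2 p, p \in l & forall q, q \in l -> iv_le q p.
Proof.
elim: l => // p l IHl _; case: (eqVneq l [::]) => [->|/IHl[q ql qmax]].
  by exists p => [|q]; rewrite inE// => /eqP->; apply: iv_le_refl.
have [pq|] := boolP (iv_le p q).
  by exists q => [|s]; rewrite inE ?ql ?orbT// => /orP[/eqP->|/qmax].
rewrite -iv_ltNge => qp; exists p => [|s]; first exact: mem_head.
rewrite inE => /orP[/eqP->|/qmax sq]; first exact: iv_le_refl.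
by apply: iv_le_trans sq (iv_lt_le qp).
Qed.

(** A nonzero polynomial vector has finitely many monomials and at least one, so the choice in
    [SuppPlus] is the true maximum and not the default. *)
Lemma SuppPlusP c a (r := Diagz F c *m vpoly a) : a != 0 ->
  (exists2 u, monomials_of r u & SuppPlus r = Iv u) /\
  forall u, monomials_of r u -> iv_le (Iv u) (SuppPlus r).
Proof.
move=> a0; apply: (xgetPex (ord0, +oo%E) (P := [set p : 'I_m * \bar int |
  (exists2 u, monomials_of r u & p = Iv u) /\
  forall u, monomials_of r u -> iv_le (Iv u) p]%classic)).
pose l := [seq (q.1, (c q.1 - q.2%:Z)%:E%E) |
  q <- [seq (j, i) | j <- enum 'I_m, i <- iota 0 (size (a j 0))]
  & (a q.1 0)`_q.2 != 0].
have lP j i : (a j 0)`_i != 0 -> (j, (c j - i%:Z)%:E%E) \in l.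
  move=> ai; apply/mapP; exists (j, i) => //; rewrite mem_filter /= ai /=.
  apply/allpairsPdep; exists j, i; split; rewrite ?mem_enum// mem_iota /=.
  by rewrite add0n ltnNge; apply: contraNN ai => /(nth_default 0)->.
have IvE j i : Iv (monomial F (i%:Z - c j) j) = (j, (c j - i%:Z)%:E%E).
  by rewrite Iv_monomial opprB.
have l0 : l != [::].
  apply: contraNneq a0 => l0; apply/eqP/colP => j; rewrite mxE; apply/polyP => i.
  rewrite coef0; apply/eqP; apply: contraTT isT => /lP; by rewrite l0.
have [p /mapP[[j i]]] := iv_max_exists l0.
rewrite mem_filter /= => /andP[ai _] -> pmax.
exists (j, (c j - i%:Z)%:E%E); split.
  by exists (monomial F (i%:Z - c j) j) => //; apply/monomials_of_Diagz_vpoly; exists j, i.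
by move=> u /monomials_of_Diagz_vpoly[j' [i' [/lP ai' ->]]]; rewrite IvE; exact: pmax.
Qed.

Lemma coef_Delta_floor c b j i : (Delta_floor c b j 0)`_i =
  if iv_lt (j, (c j - i%:Z)%:E%E) (Iv (Diagz F c *m vfrac b))
  then (vfloor b j 0)`_i else 0.
Proof.
rewrite mxE coef_poly Iv_Diagz_monomial; case: ltnP => // si.
by rewrite nth_default// if_same.
Qed.

(** The terms left to epsilon are just those that do not precede [Iv] of the weighted fractional
    part. *)
Lemma psi_admissible k s : admissible s (psi_strategy k s).
Proof.
rewrite /admissible /psi_strategy; set c := step_c s; set b := step_rho s.
case: (Iv_cases c (vfrac b)) => [[b0 bE]|[h [v [bw bn bE]]]].
  have -> : vfloor b - Delta_floor c b = 0.
    apply/eqP; rewrite subr_eq0; apply/eqP/colP => j; apply/polyP => i.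
    by rewrite coef_Delta_floor bE iv_lt_top.
  by rewrite vpoly0 mulmx0 Iv0 bE iv_le_refl.
rewrite bE; apply: wge_iv_le => j t tv; rewrite vpoly_eq lpolyE; case: ifP => // t0.
have eE (d e : Pvec) : (d - e) j 0 = d j 0 - e j 0 by rewrite !mxE.
rewrite eE coefB coef_Delta_floor bE ifT ?subrr//.
by rewrite iv_lt_fin; move: tv; case: ltnP => _; lia.
Qed.

Lemma psi_admissible_for r : admissible_for r (@psi_strategy F n).
Proof. by move=> k _; apply: psi_admissible. Qed.

(** The monomials kept in a digit precede [Iv] of the weighted fractional part, which by
    [admissible_Iv] and [output_Iv] is the right-hand side of Condition 4. *)
Lemma psi_strict r : Sset F n r -> Cstar F n (psi r).
Proof.
move=> rS; have adm := @psi_admissible_for r.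
have mC := output_mCF rS adm; split=> // -[//|k] _ lk; rewrite -/(psi r) in mC lk *.
have lk1 := lt_lenW (leqnSn _) lk.
rewrite /iv_after -/(cv _ _ _) -(output_Iv rS adm lk) /cf_D -/(cv _ _).
pose s := run r (@psi_strategy F n) k.
(* Excludes the infinite default value of [SuppPlus]. *)
have a0 : cf_a (psi r) k.+1 != 0.
  have [_] := mCF_a mC lk1; apply: contra_neq => ->.
  by rewrite vpoly0 mxE.
have aE : cf_a (psi r) k.+1 = Delta_floor (cv (psi r) k.+1) (step_rho s).
  have [/(_ k lk1)[_ dE] _] := output_cases r (@psi_strategy F n).
  rewrite /cf_a dE -[LHS]/(vfloor (step_rho s) - psi_strategy k s) subKr.
  by have [<- _] := output_run rS adm lk1.
rewrite aE in a0 *.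
have -> : st_beta (run r (@psi_strategy F n) k.+1) =
    vfrac (step_rho s) + vpoly (psi_strategy k s) by [].
have cE : cv (psi r) k.+1 = step_c s by have [<- _] := output_run rS adm lk1.
rewrite cE in a0; rewrite -[Diagz F (cv _ _)]/(Diagz F (cv (psi r) k.+1)) cE.
rewrite admissible_Iv; last exact: psi_admissible.
have [[u /monomials_of_Diagz_vpoly[j [i [ai uE]]] ->] _] := SuppPlusP (step_c s) a0.
move: ai; rewrite coef_Delta_floor uE Iv_monomial opprB.
by case: ifP; rewrite ?eqxx.
Qed.

(** It suffices that the Delta-polynomial part of rho = a + beta is a, which is checked coefficient
    by coefficient. *)
Lemma psi_phi C : Cstar F n C -> psi (phi C) = C.
Proof.
case=> mC c4; have [beta [b0 bt bs]] := tails_exist mC.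
apply: (output_tails b0 bt bs) => k lk s.
have [_ cE rE] := tail_step bt lk; rewrite -/s in cE rE.
rewrite /psi_strategy cE; congr (_ - _).
apply/colP => j; apply/polyP => i; rewrite coef_Delta_floor rE vfracD vfloorD.
rewrite mxE coefD.
have [lk2|lk2] := boolP (lt_len k.+2 C); last first.
  (* Condition 4 does not constrain the last digit, but there beta = 0 and all terms are kept. *)
  rewrite (bs _ lk lk2) vfrac0 vfloor0 mulmx0 Iv0 iv_lt_top mxE coef0 addr0//.
have IvE := tail_Iv bt lk2; set h := cf_h C k.+2 in IvE.
have hv : cv C k.+1 h < cv C k.+2 h.
  by have := cvS C k.+1; have := mCF_t mC lk2; rewrite -/h; lia.
rewrite (Iv_vfrac IvE hv).
case: ifPn => [lt|nlt].
  (* A kept monomial precedes the leading monomial of beta, so beta contributes nothing to it. *)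
  have [/wge_vfloor bw _] := Iv_finP IvE.
  have : vpoly (vfloor (beta k.+1)) j 0 (- i%:Z) = 0.
    by apply: bw; move: lt; rewrite iv_lt_fin; case: (ltnP j h) => _; lia.
  by rewrite vpoly_eq lpolyE ifT ?abszN ?absz_nat => [->|]; [rewrite addr0|lia].
(* A dropped monomial does not occur in a: by Condition 4 all monomials of a precede the leading one
   of beta. *)
apply/esym/eqP; apply: contraNT nlt => ai.
have a0 : cf_a C k.+1 != 0 by apply: contraNneq ai => ->; rewrite mxE coef0.
have [_ sP] := SuppPlusP (cv C k.+1) a0.
apply: iv_le_lt_trans (c4 k.+1 isT lk2).
have -> : (j, (cv C k.+1 j - i%:Z)%:E%E) = Iv (monomial F (i%:Z - cv C k.+1 j) j).
  by rewrite Iv_monomial opprB.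
by apply: sP; apply/monomials_of_Diagz_vpoly; exists j, i.
Qed.

Lemma phi_psi r : Sset F n r -> phi (psi r) = r.
Proof. by move=> rS; apply: phi_output => //; apply: psi_admissible_for. Qed.

End Psi.

Theorem theorem6p10 (F : fieldType) (n : nat) :
  (forall r : 'cV[laurent F]_n.+1, Sset F n r -> Tset r = CFset r) /\
  [/\ set_bij (Sset F n) (Cstar F n) (@psi F n),
      forall r : 'cV[laurent F]_n.+1, Sset F n r -> phi (psi r) = r &
      forall C : precf F n, Cstar F n C -> psi (phi C) = C].
Proof.
split; first exact: Tset_CFset.
split; [split|exact: phi_psi|exact: psi_phi].
- by move=> r; apply: psi_strict.
- move=> r s /set_mem rS /set_mem sS rs.
  by rewrite -(phi_psi rS) -(phi_psi sS) rs.
- by move=> C CS; exists (phi C); [apply: phi_Sset; case: CS|apply: psi_phi].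
Qed.
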